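(* Let $p$ be a prime, let $d\ge 2$ be an integer, and let $q=p^k$ with $k\in\{1,2,\ldots,\infty\}$ (with the convention $p^\infty=0$), where $k\ge 2$ if $p=2$. Let $z_1,z_2\in\{x_1,y_1,\ldots,x_d,y_d\}$ be such that $z_1\ne z_2$ and $\{z_1,z_2\}\ne\{x_i,y_i\}$ for every $1\le i\le d$. Let $G$ be the pro-$p$ group with pro-$p$ presentation $$G=\left\langle x_1,y_1,\ldots,x_d,y_d \mid x_1^q[x_1,y_1]\cdots[x_d,y_d]=[z_1,z_2]=1\right\rangle_{\hat p}.$$ Then $G$ is not 1-cyclotomic. In particular, $G$ does not occur as the maximal pro-$p$ Galois group $G_{\mathbb K}(p)$ of a field $\mathbb K$ containing a (primitive) root of unity of order $p$ (and also $\sqrt{-1}$ if $p=2$).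
   Context: Commutators: $[x,y]=x^{-1}y^{-1}xy$. The subscript $\hat p$ denotes a presentation in the category of pro-$p$ groups. All subgroups of pro-$p$ groups are assumed closed. A pro-$p$ group $G$ is 1-cyclotomic if there exists a continuous $G$-module $M$, with $M\simeq\mathbb Z_p$ as an abelian pro-$p$ group, such that for every closed subgroup $H\le G$ and every $n\ge 1$ the natural map $\mathrm H^1(H,M/p^nM)\to \mathrm H^1(H,M/pM)$, induced by the projection $M/p^nM\to M/pM$ of $H$-modules, is surjective. For a field $\mathbb K$, $\mathbb K(p)$ is the compositum of all finite Galois extensions of $\mathbb K$ of $p$-power degree, and $G_{\mathbb K}(p)=\mathrm{Gal}(\mathbb K(p)/\mathbb K)$. *)

(* Defs.v *)
From HB Require Import structures.
From mathcomp Require Import all_boot all_order all_algebra falgebra fieldext galois.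
From mathcomp Require Import all_classical topology.
From mathcomp Require Import pseudometric_normed_Zmodule tvs.
Set Implicit Arguments.
Unset Strict Implicit.
Unset Printing Implicit Defensive.
Import GRing.Theory.
Local Open Scope classical_set_scope.
Local Open Scope group_scope.

HB.mixin Record isTopologicalGroup G of Group G & Topological G := {
  mulg_continuous : continuous (fun x : G * G => x.1 * x.2);
  invg_continuous : continuous (fun x : G => x^-1)
}.

#[short(type="topologicalGroupType")]
HB.structure Definition TopologicalGroup :=
  {G of Group G & Topological G & isTopologicalGroup G}.

Section ProP.
Variable (p : nat).

Definition is_subgroup (G : groupType) (H : set G) : Prop :=
  H 1 /\ forall x y, H x -> H y -> H (x * y^-1).

Definition is_normal_subgroup (G : groupType) (N : set G) : Prop :=
  is_subgroup N /\ forall x g, N x -> N (x ^ g).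

Definition left_cosets (G : groupType) (H : set G) : set (set G) :=
  [set [set g * h | h in H] | g in [set: G]].

Definition profinite_group (G : topologicalGroupType) : Prop :=
  [/\ hausdorff_space G, compact [set: G]
    & forall U : set G, nbhs (1 : G) U ->
        exists H : set G, [/\ is_subgroup H, open H & H `<=` U]].

Definition pro_p_group (G : topologicalGroupType) : Prop :=
  profinite_group G /\
  forall N : set G, is_normal_subgroup N -> open N ->
    exists m : nat, (left_cosets N #= `I_(p ^ m)%N)%card.

Definition continuous_hom (G H : topologicalGroupType) (f : G -> H) : Prop :=
  {morph f : x y / x * y} /\ continuous f.

(* [rels H h] says that the family [h] of elements of [H] satisfies the
   defining relations. A presentation in the category of pro-p groups is an
   initial pro-p group equipped with such a family. *)
Definition pro_p_presentation (X : Type)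
    (rels : forall H : groupType, (X -> H) -> Prop)
    (G : topologicalGroupType) (g : X -> G) : Prop :=
  [/\ pro_p_group G, rels G g
    & forall (H : topologicalGroupType) (h : X -> H),
        pro_p_group H -> rels H h ->
        exists f : G -> H,
          [/\ continuous_hom f, f \o g =1 h
            & forall f' : G -> H,
                continuous_hom f' -> f' \o g =1 h -> f' =1 f]].

End ProP.

Definition topgroup_isog (G H : topologicalGroupType) : Prop :=
  exists (f : G -> H) (f' : H -> G),
    [/\ {morph f : x y / x * y}, cancel f f', cancel f' f,
        continuous f & continuous f'].

Section PadicIntegers.
Local Open Scope ring_scope.
Variable p : nat.

(* The inverse limit of the Z/p^n: the n-th coordinate is the canonical
   representative in [0, p^n) of a residue class modulo p^n. *)
Record padic_int : Type := PadicInt {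
  padic_coord :> nat -> int;
  padic_compat : forall n, padic_coord n = (padic_coord n.+1 %% p%:Z ^+ n)%Z
}.

Lemma padicP (x y : padic_int) : x =1 y -> x = y.
Proof.
case: x y => x xP [y yP] /= /funext xy; subst y.
by congr PadicInt; exact: Prop_irrelevance.
Qed.

HB.instance Definition _ := gen_eqMixin padic_int.
HB.instance Definition _ := gen_choiceMixin padic_int.

Lemma modz_padic (a : int) n :
  ((a %% p%:Z ^+ n.+1)%Z %% p%:Z ^+ n)%Z = (a %% p%:Z ^+ n)%Z.
Proof.
rewrite exprSr [in RHS](divz_eq a (p%:Z ^+ n * p%:Z)).
by rewrite mulrA mulrAC modzMDl.
Qed.

Lemma padic_mod (x : padic_int) n : (x n %% p%:Z ^+ n)%Z = x n.
Proof. by rewrite padic_compat modz_mod. Qed.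

Fact padic_of_subproof (u : nat -> int) :
  (forall n, (u n.+1 %% p%:Z ^+ n)%Z = (u n %% p%:Z ^+ n)%Z) ->
  forall n, (u n %% p%:Z ^+ n)%Z = ((u n.+1 %% p%:Z ^+ n.+1)%Z %% p%:Z ^+ n)%Z.
Proof. by move=> uP n; rewrite modz_padic uP. Qed.

Definition padic_of u uP := PadicInt (@padic_of_subproof u uP).

Fact padic_zero_subproof n :
  ((0 : int) %% p%:Z ^+ n)%Z = ((0 : int) %% p%:Z ^+ n)%Z.
Proof. by []. Qed.

Fact padic_opp_subproof (x : padic_int) n :
  ((- x n.+1) %% p%:Z ^+ n)%Z = ((- x n) %% p%:Z ^+ n)%Z.
Proof. by rewrite [x n]padic_compat modzNm. Qed.

Fact padic_add_subproof (x y : padic_int) n :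
  ((x n.+1 + y n.+1) %% p%:Z ^+ n)%Z = ((x n + y n) %% p%:Z ^+ n)%Z.
Proof. by rewrite [x n]padic_compat [y n]padic_compat modzDm. Qed.

Definition padic_zero := padic_of padic_zero_subproof.
Definition padic_opp x := padic_of (padic_opp_subproof x).
Definition padic_add x y := padic_of (padic_add_subproof x y).

Fact padic_addA : associative padic_add.
Proof. by move=> x y z; apply: padicP => n /=; rewrite modzDml modzDmr addrA. Qed.

Fact padic_addC : commutative padic_add.
Proof. by move=> x y; apply: padicP => n /=; rewrite addrC. Qed.

Fact padic_add0 : left_id padic_zero padic_add.
Proof. by move=> x; apply: padicP => n /=; rewrite mod0z add0r padic_mod. Qed.

Fact padic_addN : left_inverse padic_zero padic_opp padic_add.
Proof. by move=> x; apply: padicP => n /=; rewrite modzDml addNr. Qed.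

HB.instance Definition _ :=
  GRing.isZmodule.Build padic_int padic_addA padic_addC padic_add0 padic_addN.

(* The inverse limit topology: the sets {y | y n = x n} form a base. *)
Definition padic_open (U : set padic_int) : Prop :=
  forall x, U x -> exists n, forall y : padic_int, y n = x n -> U y.

Fact padic_openT : padic_open setT.
Proof. by move=> x _; exists 0%N. Qed.

Lemma padic_coord_le (x y : padic_int) m n :
  (m <= n)%N -> x n = y n -> x m = y m.
Proof.
move=> /subnKC <-; elim: (n - m)%N => [|k IH]; first by rewrite addn0.
by rewrite addnS => xy; apply: IH; rewrite padic_compat xy -padic_compat.
Qed.

Fact padic_openI U V : padic_open U -> padic_open V -> padic_open (U `&` V).
Proof.
move=> oU oV x [/oU[m Um] /oV[n Vn]]; exists (maxn m n) => y yx; split.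
  by apply: Um; apply: padic_coord_le yx; exact: leq_maxl.
by apply: Vn; apply: padic_coord_le yx; exact: leq_maxr.
Qed.

Fact padic_open_bigU (I : Type) (f : I -> set padic_int) :
  (forall i, padic_open (f i)) -> padic_open (\bigcup_i f i).
Proof.
move=> of_ x [i _ /of_[n fn]]; exists n => y yx; exists i => //; exact: fn.
Qed.

HB.instance Definition _ :=
  isOpenTopological.Build padic_int padic_openT padic_openI padic_open_bigU.

Fact padic_sub_continuous :
  continuous (fun x : padic_int * padic_int => x.1 - x.2).
Proof.
move=> [x y] U; rewrite nbhsE => -[V [oV /= /oV[n Vn]] VU].
have nb (z : padic_int) : nbhs z [set t : padic_int | t n = z n].
  rewrite nbhsE; exists [set t : padic_int | t n = z n] => //; split=> //.
  by move=> t tz; exists n => u ut; rewrite /= ut tz.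
exists ([set t : padic_int | t n = x n], [set t : padic_int | t n = y n]).
  by split; exact: nb.
by move=> [x' y'] [/= x'x y'y]; apply/VU/Vn => /=; rewrite x'x y'y.
Qed.

HB.instance Definition _ :=
  PreTopologicalNmodule_isTopologicalZmodule.Build padic_int padic_sub_continuous.

End PadicIntegers.

Definition topzmod_isog (M N : topologicalZmodType) : Prop :=
  exists (f : M -> N) (f' : N -> M),
    [/\ {morph f : x y / (x + y)%R}, cancel f f', cancel f' f,
        continuous f & continuous f'].

Section ModQuotient.
Local Open Scope ring_scope.
Local Open Scope quotient_scope.
Variables (M : topologicalZmodType) (N : nat).

Definition multiples : {pred M} := fun x => `[< exists y, x = y *+ N >].

Fact multiples_zmod_closed : zmod_closed multiples.
Proof.
split; first by apply/asboolP; exists 0; rewrite mul0rn.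
move=> x y /asboolP[a ->] /asboolP[b ->]; apply/asboolP.
by exists (a - b); rewrite mulrnBl.
Qed.

HB.instance Definition _ :=
  GRing.isZmodClosed.Build M multiples multiples_zmod_closed.

Definition modquot : Type := Quotient.quot multiples.

HB.instance Definition _ := GRing.Zmodule.on modquot.

Definition modproj (x : M) : modquot := \pi_(Quotient.quot multiples) x.
Definition modrepr (x : modquot) : M := repr (x : Quotient.quot multiples).

Definition modquot_open (U : set modquot) : Prop := open (modproj @^-1` U).

Fact modquot_openT : modquot_open setT.
Proof. by rewrite /modquot_open preimage_setT; exact: openT. Qed.

Fact modquot_openI U V :
  modquot_open U -> modquot_open V -> modquot_open (U `&` V).
Proof. exact: openI. Qed.

Fact modquot_open_bigU (I : Type) (f : I -> set modquot) :
  (forall i, modquot_open (f i)) -> modquot_open (\bigcup_i f i).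
Proof. by move=> of_; apply: bigcup_open => i _; exact: of_. Qed.

HB.instance Definition _ :=
  isOpenTopological.Build modquot modquot_openT modquot_openI modquot_open_bigU.

End ModQuotient.

Section Cohomology.
Local Open Scope ring_scope.
Variables (G : topologicalGroupType).

Definition continuous_action (M : topologicalZmodType) (act : G -> M -> M) :
    Prop :=
  [/\ forall m, act 1%g m = m,
      forall g h m, act (g * h)%g m = act g (act h m),
      forall g, {morph act g : m n / m + n}
    & continuous (fun x : G * M => act x.1 x.2)].

Section H1.
Variables (A : PreTopologicalZmodule.type) (act : G -> A -> A) (H : set G).

(* Cochains on [H] are total functions on [G] of which only the restriction to
   [H] matters: [cohomologous] compares them on [H] only, so functions with the
   same restriction have the same class. *)
Definition cocycle (c : G -> A) : Prop :=
  {within H, continuous c} /\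
  forall g h, H g -> H h -> c (g * h)%g = c g + act g (c h).

Definition cohomologous (c c' : G -> A) : Prop :=
  exists a : A, forall h, H h -> c h - c' h = act h a - a.

Definition cohomology_class (c : G -> A) : set (G -> A) :=
  [set c' | cocycle c' /\ cohomologous c c'].

Definition H1 : set (set (G -> A)) :=
  [set cohomology_class c | c in cocycle].

End H1.

Definition H1_map (A B : PreTopologicalZmodule.type) (actB : G -> B -> B)
    (H : set G) (phi : A -> B) (C : set (G -> A)) : set (G -> B) :=
  \bigcup_(c in C) cohomology_class actB H (phi \o c).

Definition modquot_act (M : topologicalZmodType) (act : G -> M -> M) (N : nat)
    (g : G) (x : modquot M N) : modquot M N :=
  modproj N (act g (modrepr x)).

Definition modquot_proj (M : topologicalZmodType) (N N' : nat)
    (x : modquot M N) : modquot M N' :=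
  modproj N' (modrepr x).

Definition one_cyclotomic (p : nat) : Prop :=
  exists (M : topologicalZmodType) (act : G -> M -> M),
    [/\ continuous_action act, topzmod_isog M (padic_int p)
      & forall (H : set G) (n : nat), is_subgroup H -> closed H -> (1 <= n)%N ->
          set_surj (H1 (@modquot_act M act (p ^ n)%N) H)
                   (H1 (@modquot_act M act p) H)
                   (H1_map (@modquot_act M act p) H
                           (@modquot_proj M (p ^ n)%N p))].

End Cohomology.

Section GaloisGroup.
Local Open Scope ring_scope.
Variables (K L : fieldType) (iota : {rmorphism K -> L}).

Record galois_group : Type := GaloisAut {
  galois_aut :> L -> L;
  galois_autP : [/\ bijective galois_aut, zmod_morphism galois_aut,
      monoid_morphism galois_aut & forall a, galois_aut (iota a) = iota a]
}.

Lemma galois_groupP (s t : galois_group) : s =1 t -> s = t.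
Proof.
case: s t => s sP [t tP] /= /funext st; subst t.
by congr GaloisAut; exact: Prop_irrelevance.
Qed.

HB.instance Definition _ := gen_eqMixin galois_group.
HB.instance Definition _ := gen_choiceMixin galois_group.

Fact gal_one_subproof :
  [/\ bijective (@id L), zmod_morphism (@id L), monoid_morphism (@id L)
    & forall a, id (iota a) = iota a].
Proof. by split=> //; exists id. Qed.
Definition gal_one := GaloisAut gal_one_subproof.

Fact gal_mul_subproof (s t : galois_group) :
  [/\ bijective (s \o t), zmod_morphism (s \o t), monoid_morphism (s \o t)
    & forall a, (s \o t) (iota a) = iota a].
Proof.
case: s t => [s [sb sa [s1 sm] sK]] [t [tb ta [t1 tm] tK]] /=.
split; first exact: bij_comp.
- by move=> x y /=; rewrite ta sa.
- by split=> [|x y] /=; rewrite ?t1 ?s1 ?tm ?sm.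
- by move=> a /=; rewrite tK sK.
Qed.
Definition gal_mul s t := GaloisAut (gal_mul_subproof s t).

Fact gal_inv_ex (s : galois_group) :
  {t : galois_group | cancel (galois_aut s) (galois_aut t)
    & cancel (galois_aut t) (galois_aut s)}.
Proof.
apply: cid2; case: s => [s [[t st ts] sa [s1 sm] sK]] /=.
suff tP : [/\ bijective t, zmod_morphism t, monoid_morphism t
    & forall a, t (iota a) = iota a] by exists (GaloisAut tP).
split; first by exists s.
- by move=> x y; apply: (can_inj st); rewrite sa !ts.
- split=> [|x y]; first by rewrite -[RHS]st s1.
  by apply: (can_inj st); rewrite sm !ts.
- by move=> a; apply: (can_inj st); rewrite sK ts.
Qed.
Definition gal_inv s := s2val (gal_inv_ex s).

Fact gal_invK s : cancel (galois_aut s) (galois_aut (gal_inv s)).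
Proof. exact: s2valP (gal_inv_ex s). Qed.
Fact gal_invKV s : cancel (galois_aut (gal_inv s)) (galois_aut s).
Proof. exact: s2valP' (gal_inv_ex s). Qed.

Fact gal_mulA : associative gal_mul.
Proof. by move=> s t u; apply: galois_groupP. Qed.
Fact gal_mul1 : left_id gal_one gal_mul.
Proof. by move=> s; apply: galois_groupP. Qed.
Fact gal_1mul : right_id gal_one gal_mul.
Proof. by move=> s; apply: galois_groupP. Qed.
Fact gal_mulV : left_inverse gal_one gal_inv gal_mul.
Proof. by move=> s; apply: galois_groupP => x /=; rewrite gal_invK. Qed.
Fact gal_Vmul : right_inverse gal_one gal_inv gal_mul.
Proof. by move=> s; apply: galois_groupP => x /=; rewrite gal_invKV. Qed.

HB.instance Definition _ := isGroup.Build galois_group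
  gal_mulA gal_mul1 gal_1mul gal_mulV gal_Vmul.

(* The Krull topology, for [L] algebraic over [K]: the automorphisms agreeing
   with [s] on a finite set [r] form the coset s Gal(L/K(r)), and the K(r) are
   exactly the finite subextensions of L/K. *)
Definition krull_open (U : set galois_group) : Prop :=
  forall s, U s -> exists r : seq L,
    forall t : galois_group, {in r, t =1 s} -> U t.

Fact krull_openT : krull_open setT.
Proof. by move=> s _; exists [::]. Qed.

Fact krull_openI U V : krull_open U -> krull_open V -> krull_open (U `&` V).
Proof.
move=> oU oV s [/oU[q Uq] /oV[r Vr]]; exists (q ++ r) => t ts.
by split; [apply: Uq|apply: Vr] => x xr; apply: ts; rewrite mem_cat xr ?orbT.
Qed.

Fact krull_open_bigU (I : Type) (f : I -> set galois_group) :
  (forall i, krull_open (f i)) -> krull_open (\bigcup_i f i).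
Proof.
move=> of_ s [i _ /of_[r fr]]; exists r => t ts; exists i => //; exact: fr.
Qed.

HB.instance Definition _ :=
  isOpenTopological.Build galois_group krull_openT krull_openI krull_open_bigU.

Lemma krull_agree_nbhs (s : galois_group) (r : seq L) :
  nbhs s [set t : galois_group | {in r, t =1 s}].
Proof.
rewrite nbhsE; exists [set t : galois_group | {in r, t =1 s}] => //; split=> //.
by move=> t ts; exists r => u ut x xr; rewrite ut// ts.
Qed.

Lemma krull_nbhs (s : galois_group) (U : set galois_group) : nbhs s U ->
  exists r : seq L, forall t : galois_group, {in r, t =1 s} -> U t.
Proof.
rewrite nbhsE => -[V [oV Vs] VU]; have [r Vr] := oV _ Vs.
by exists r => t /Vr/VU.
Qed.

Fact gal_mul_continuous :
  continuous (fun x : galois_group * galois_group => (x.1 * x.2)%g).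
Proof.
move=> [s t] U /krull_nbhs[r Ur].
exists ([set s' : galois_group | {in map t r, s' =1 s}],
        [set t' : galois_group | {in r, t' =1 t}]).
  by split; exact: krull_agree_nbhs.
move=> [s' t'] [/= s's t't]; apply: Ur => x xr /=.
by rewrite t't// s's// map_f.
Qed.

Fact gal_inv_continuous : continuous (fun x : galois_group => (x^-1)%g).
Proof.
move=> s U /krull_nbhs[r Ur].
apply: filterS (krull_agree_nbhs s (map (gal_inv s) r)) => s' /= s's.
apply: Ur => x xr; rewrite -[in LHS](gal_invKV s x) -s's ?map_f//.
by rewrite gal_invK.
Qed.

HB.instance Definition _ := isTopologicalGroup.Build galois_group
  gal_mul_continuous gal_inv_continuous.

End GaloisGroup.

Section MaximalPExtension.
Local Open Scope ring_scope.
Variable p : nat.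

Definition is_subfield (F : fieldType) (E : set F) : Prop :=
  [/\ E 1, forall x y, E x -> E y -> E (x - y)
    & forall x y, E x -> E y -> E (x / y)].

Definition is_algebraic_closure (K : fieldType) (Omega : closedFieldType)
    (iota : {rmorphism K -> Omega}) : Prop :=
  forall x : Omega, algebraicOver iota x.

Definition galois_p_subextensions (K Omega : fieldType)
    (iota : {rmorphism K -> Omega}) : set (set Omega) :=
  [set E | exists (E0 : splittingFieldType K) (f : {rmorphism E0 -> Omega}),
    [/\ galois 1%VS {:E0}, exists m : nat, \dim {:E0} = (p ^ m)%N,
        forall a : K, f a%:A = iota a & E = range f]].

Definition compositum (Omega : fieldType) (Es : set (set Omega)) : set Omega :=
  smallest (@is_subfield Omega) (\bigcup_(E in Es) E).

(* [L], with the embedding [iota], is a copy of K(p). *)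
Definition is_max_p_extension (K L : fieldType) (iota : {rmorphism K -> L}) :
    Prop :=
  exists (Omega : closedFieldType) (j : {rmorphism L -> Omega}),
    is_algebraic_closure (j \o iota) /\
    range j = compositum (galois_p_subextensions (j \o iota)).

End MaximalPExtension.

(* The exponent [None] stands for infinity, with p^oo = 0. *)
Definition ext_expn (p : nat) (k : option nat) : nat :=
  if k is Some m then (p ^ m)%N else 0%N.

(* The generators x_i and y_i are indexed by (i, false) and (i, true). *)
Notation gen_x i := (i, false) (only parsing).
Notation gen_y i := (i, true) (only parsing).

Definition surface_relations (d q : nat) (i1 : 'I_d) (z1 z2 : 'I_d * bool)
    (H : groupType) (h : 'I_d * bool -> H) : Prop :=
  h (gen_x i1) ^+ q * \big[*%g/1]_(i < d) [~ h (gen_x i), h (gen_y i)] = 1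
  /\ [~ h z1, h z2] = 1.

(* Main.v *)
(* A 1-cyclotomic G carries an action on A = Z/p^2, trivial modulo p, such that
   every character chi : H -> F_p of an open subgroup H lifts to a cocycle
   H -> A.  Lifting the characters dual to the generators and evaluating the
   cocycles on the relators forces every generator to act trivially on A, except
   y_1, for which y_1 - 1 acts as q.

   By symmetry one may assume z_1 <> y_1 and z_2 <> x_1.  Write z' for the
   partner of z (x_i' = y_i and y_i' = x_i), let H be the kernel of the map
   G -> F_p^2 dual to (z_1', z_2), and let h = [z_2, z_2'].  For a cocycle c on H:
   - z_2^n centralises z_1, and acts on z_1^{z_1'} as an element of H, because
     (z_2^n)^{z_1'} centralises z_1^{z_1'}; hence c([z_1, z_1']) is invariant
     under conjugation by z_2^n;
   - all other factors of the surface relation have z_2^n-invariant values too,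
     so c(h) is invariant;
   - z_2^{z_2'} = z_2 h, hence (z_2^p)^{z_2'} = (z_2 h)^p and p c(h) = 0.
   But an extraspecial group of order p^5 is a quotient of G on which some
   character chi of H has chi(h) = 1, so that p c(h) <> 0.

   For G = G_K(p) the lifting property is Kummer theory: by Hilbert 90 a
   character H -> mu_p is s |-> s(b)/b for some b in K(p), and a p-th root beta of
   b, which lies in K(p) again, gives the cocycle s |-> s(beta)/beta with values
   in mu_{p^2}. *)
From HB Require Import structures.
Require Import Defs.
From mathcomp Require Import all_boot all_order all_algebra.
From mathcomp Require Import all_fingroup all_solvable all_field ring.
From mathcomp Require Import all_classical topology.
From mathcomp Require Import pseudometric_normed_Zmodule tvs.
Set Implicit Arguments.
Unset Strict Implicit.
Unset Printing Implicit Defensive.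
Import Order.TTheory GRing.Theory Num.Theory.
Local Open Scope classical_set_scope.
Local Open Scope group_scope.

(** * Finite p-groups as pro-p groups *)

Lemma card_eq_finset (T : finType) (S : {set T}) :
  ([set x | x \in S] #= `I_#|S|)%card.
Proof.
apply/card_set_bijP; exists (index^~ (enum S)); split.
- by move=> x /= xS; rewrite cardE index_mem mem_enum.
- move=> x y; rewrite !inE /= => xS yS xy.
  by rewrite -(nth_index x (s := enum S) (x := x)) ?mem_enum// xy nth_index ?mem_enum.
- move=> i /= ; rewrite cardE => iS; case: (enum S) (mem_enum S) (enum_uniq S) iS =>
  // x0 s xs us iS.
  exists (nth x0 (x0 :: s) i); first by rewrite /= -xs mem_nth.
  by rewrite index_uniq.
Qed.

(** An alias, so that the discrete topology is declared on it and not on every finite group type. *)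
Definition discrete (gT : finGroupType) : Type := gT.

Section DiscreteGroup.
Variable gT : finGroupType.

HB.instance Definition _ := FinGroup.on (discrete gT).

Definition discrete_open (U : set (discrete gT)) : Prop := True.

Fact discrete_openT : discrete_open setT. Proof. by []. Qed.
Fact discrete_openI U V :
  discrete_open U -> discrete_open V -> discrete_open (U `&` V).
Proof. by []. Qed.
Fact discrete_open_bigU (I : Type) (f : I -> set (discrete gT)) :
  (forall i, discrete_open (f i)) -> discrete_open (\bigcup_i f i).
Proof. by []. Qed.

HB.instance Definition _ := isOpenTopological.Build (discrete gT)
  discrete_openT discrete_openI discrete_open_bigU.

Lemma discrete_nbhs (x : discrete gT) : nbhs x [set x].
Proof. by rewrite nbhsE; exists [set x]. Qed.

Fact discrete_mul_continuous :
  continuous (fun x : discrete gT * discrete gT => x.1 * x.2).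
Proof.
move=> [x y] U /nbhs_singleton Uxy.
exists ([set x], [set y]); first by split; exact: discrete_nbhs.
by move=> [x' y'] [/= -> ->].
Qed.

Fact discrete_inv_continuous : continuous (fun x : discrete gT => x^-1).
Proof.
by move=> x U /nbhs_singleton Ux; apply: filterS (discrete_nbhs x) => y ->.
Qed.

HB.instance Definition _ := isTopologicalGroup.Build (discrete gT)
  discrete_mul_continuous discrete_inv_continuous.

(** Reflected as a finite set, [H] is a finite group; its number of cosets is an index, which
    divides the order. *)
Lemma card_left_cosets (H : set (discrete gT)) : is_subgroup H ->
  exists2 m, m %| #|gT| & (left_cosets H #= `I_m)%card.
Proof.
move=> [H1 HV]; pose K := [set x : gT | `[< H x >]]%SET.
have KP x : (x \in K) <-> H x by rewrite inE; split=> /asboolP.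
have HVV x : H x -> H x^-1 by move=> Hx; rewrite -[x^-1]mul1g; exact: HV.
have gK : group_set K.
  apply/group_setP; split=> [|x y]; first exact/KP.
  by move=> /KP Hx /KP/HVV Hy; apply/KP; rewrite -(invgK y); exact: HV.
exists #|lcosets (Group gK) [set: gT]%SET|.
  by rewrite card_lcosets -cardsT; exact: dvdn_indexg.
pose F (A : {set gT}) : set (discrete gT) := [set x | x \in A].
have imF : left_cosets H = F @` [set A | A \in lcosets K [set: gT]%SET].
  apply/seteqP; split => B /=.
    move=> [g _ <-]; exists (g *: K).
      by apply/lcosetsP; exists g; rewrite ?inE.
    apply/seteqP; split=> x /=.
      by move=> /lcosetP[h /KP hK ->]; exists h.
    by move=> [h Hh <-]; apply/lcosetP; exists h => //; exact/KP.
  move=> [A /lcosetsP[g _ ->] <-]; exists g => //.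
  apply/seteqP; split=> x /=.
    by move=> [h Hh <-]; apply/lcosetP; exists h => //; exact/KP.
  by move=> /lcosetP[h /KP hK ->]; exists h.
rewrite imF; apply: card_eq_trans (card_eq_finset _).
apply: inj_card_eq => A B _ _ AB; apply/setP => x.
have xAB : F A x = F B x by rewrite AB.
by rewrite /F /= in xAB; apply/idP/idP; rewrite xAB.
Qed.

Lemma discrete_pro_p (p n : nat) : prime p -> #|gT| = (p ^ n)%N ->
  pro_p_group p (discrete gT).
Proof.
move=> pp cardT; split; last first.
  move=> N [sN _] _; have [m] := card_left_cosets sN.
  by rewrite cardT => /(dvdn_pfactor _ _ pp)[k _ ->]; exists k.
split.
- by move=> x y xy; have [z [-> ->]] := xy _ _ (discrete_nbhs x) (discrete_nbhs y).
- exact/finite_compact/finite_finset.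
- move=> U /nbhs_singleton U1; exists [set 1]; split=> // [|x -> //].
  by split=> // x y -> ->; rewrite mulgV.
Qed.

End DiscreteGroup.

(** * An extraspecial group of order p^5 *)

Section Heis.
Variable p : nat.
Local Open Scope ring_scope.

(* [Heis s t v w z] is the upper unitriangular 4 x 4 matrix with first row
   (1, s, t, z), last column (z, w, v, 1) and identity central block. *)
Record heis := Heis {hs : 'F_p; ht : 'F_p; hv : 'F_p; hw : 'F_p; hz : 'F_p}.

Definition heis_tuple a := (hs a, ht a, hv a, hw a, hz a).
Definition tuple_heis u : heis := let: (s, t, v, w, z) := u in Heis s t v w z.
Lemma heis_tupleK : cancel heis_tuple tuple_heis.
Proof. by case. Qed.
Lemma tuple_heisK : cancel tuple_heis heis_tuple.
Proof. by case=> [[[[]]]]. Qed.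

HB.instance Definition _ := Finite.copy heis (can_type heis_tupleK).

Definition heis_one := Heis 0 0 0 0 0.
Definition heis_mul a b := Heis (hs a + hs b) (ht a + ht b) (hv a + hv b)
  (hw a + hw b) (hz a + hz b + (hs a * hw b + ht a * hv b)).
Definition heis_inv a := Heis (- hs a) (- ht a) (- hv a) (- hw a)
  (hs a * hw a + ht a * hv a - hz a).

Fact heis_mulA : associative heis_mul.
Proof. move=> a b c; congr Heis => /=; ring. Qed.
Fact heis_mul1 : left_id heis_one heis_mul.
Proof. case=> s t v w z; congr Heis => /=; ring. Qed.
Fact heis_mulV : left_inverse heis_one heis_inv heis_mul.
Proof. move=> a; congr Heis => /=; ring. Qed.

HB.instance Definition _ := Finite_isGroup.Build heis heis_mulA heis_mul1 heis_mulV.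

Lemma card_heis : prime p -> #|{: heis}| = (p ^ 5)%N.
Proof.
move=> pp; have /bij_eq_card -> : bijective heis_tuple.
  by exists tuple_heis; [exact: heis_tupleK|exact: tuple_heisK].
by rewrite !card_prod card_Fp// !expnS mulnA muln1 !mulnA.
Qed.

(** In general the last coordinate is n z + binom(n, 2) (s w + t v). The hypothesis removes the
    second term, which for p = 2 need not vanish even when p divides n. *)
Lemma heis_expg (a : heis) n : hs a * hw a + ht a * hv a = 0 ->
  (a ^+ n)%g = Heis (hs a *+ n) (ht a *+ n) (hv a *+ n) (hw a *+ n) (hz a *+ n).
Proof.
move=> a0; elim: n => [|n IH]; first by rewrite !mulr0n.
rewrite expgS IH !mulrS; congr Heis => /=.
by rewrite !mulrnAr -mulrnDl a0 mul0rn addr0.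
Qed.

Lemma heis_commg (a b : heis) :
  [~ a, b]%g = Heis 0 0 0 0 (hs a * hw b + ht a * hv b - hs b * hw a - ht b * hv a).
Proof. by congr Heis => /=; ring. Qed.
Lemma hsM : {morph (hs : heis -> _) : a b / (a * b)%g >-> a + b}.
Proof. by []. Qed.
End Heis.

(** * Cocycles with values in Z/p^2 *)

(* The shape of M/p^2M: cyclic of order p^2, generated by e, with an action that
   is trivial modulo p. *)
Record unipotent_module (p : nat) (G : groupType) (A : zmodType) (e : A)
    (act : G -> A -> A) : Prop := UnipotentModule {
  um_prime : prime p;
  um_gen : forall a, exists n, (a = e *+ n)%R;
  um_order : (e *+ (p * p) = 0)%R;
  um_nz : (e *+ p != 0)%R;
  um_act1 : forall a, act 1 a = a;
  um_actM : forall g h a, act (g * h) a = act g (act h a);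
  um_actD : forall g, {morph act g : a b / (a + b)%R};
  um_actp : forall g, (act g (e *+ p) = e *+ p)%R
}.

Section UnipotentModule.
Local Open Scope ring_scope.
Variables (p : nat) (G : groupType) (A : zmodType) (e : A)
  (act : G -> A -> A) (um : unipotent_module p e act).

Let p_prime : prime p := um_prime um.

Let act0 g : act g 0 = 0.
Proof. by apply: (addrI (act g 0)); rewrite -(um_actD um) !addr0. Qed.

Let actN g a : act g (- a) = - act g a.
Proof. by apply/eqP; rewrite -subr_eq0 opprK -(um_actD um) addNr act0. Qed.

Let actMn g a n : act g (a *+ n) = act g a *+ n.
Proof. by elim: n => [|n IH]; rewrite ?act0// !mulrS (um_actD um) IH. Qed.

Let mulpp (a : A) : a *+ p *+ p = 0.
Proof.
have [n ->] := um_gen um a.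
by rewrite -!mulrnA mulnC mulrnA (um_order um) mul0rn.
Qed.

Lemma um_dvd m : e *+ p *+ m = 0 -> (p %| m)%N.
Proof.
move=> em; apply: contraT => pm.
have m0 : (0 < m)%N by case: m pm {em} => //; rewrite dvdn0.
case: (egcdnP p m0) => u v; have /eqP -> : coprime m p.
  by rewrite coprime_sym prime_coprime.
move=> uv _; case/negP: (um_nz um); apply/eqP.
have := congr1 (fun k => e *+ p *+ k) uv.
by rewrite /= mulnC mulrnA em mul0rn addn1 mulrSr mulnC mulrnA mulpp mul0rn add0r.
Qed.

Lemma um_torsion (a : A) : a *+ p = 0 -> exists b, a = b *+ p.
Proof.
have [n ->] := um_gen um a; rewrite mulrnAC => /um_dvd/dvdnP[m ->].
by exists (e *+ m); rewrite mulrnA.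
Qed.

Lemma act_torsion g a : a *+ p = 0 -> act g a = a.
Proof.
move=> /um_torsion[b ->]; have [n ->] := um_gen um b.
by rewrite mulrnAC actMn (um_actp um).
Qed.

(** The operator g - 1 on [A]. It kills the p-torsion, which is pA, and takes values in it; hence it
    is additive in [g], invariant under conjugation of [g] and zero on commutators. *)
Definition disp (g : G) (a : A) := act g a - a.

Lemma actE g a : act g a = a + disp g a.
Proof. by rewrite addrC subrK. Qed.

Lemma disp_torsion g a : disp g a *+ p = 0.
Proof.
by rewrite mulrnBl -actMn act_torsion ?subrr// mulpp.
Qed.

Lemma dispD g a b : disp g (a + b) = disp g a + disp g b.
Proof. by rewrite /disp (um_actD um) opprD addrACA. Qed.

(** Values of lifted characters are only known after multiplication by p; this is enough to evaluate
    g - 1 on them. *)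
Lemma disp_eq g a b : a *+ p = b *+ p -> disp g a = disp g b.
Proof.
move=> ab; rewrite -(subrK b a) dispD {1}/disp act_torsion ?subrr ?add0r//.
by rewrite mulrnBl ab subrr.
Qed.

Lemma disp0 g a : a *+ p = 0 -> disp g a = 0.
Proof. by move=> a0; rewrite /disp act_torsion// subrr. Qed.

(** gh - 1 = (g - 1) + (h - 1) + (g - 1)(h - 1), and the product is zero because h - 1 lands in the
    torsion, which [g] fixes. *)
Lemma dispM g h a : disp (g * h) a = disp g a + disp h a.
Proof.
rewrite {1}/disp (um_actM um) (actE h a) (um_actD um).
by rewrite (act_torsion g (disp_torsion h a)) addrAC.
Qed.

Lemma disp1 a : disp 1%g a = 0.
Proof. by rewrite /disp (um_act1 um) subrr. Qed.

Lemma dispV g a : disp g^-1%g a = - disp g a.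
Proof. by apply/eqP; rewrite -subr_eq0 opprK -dispM mulVg disp1. Qed.

Lemma dispJ g h a : disp (g ^ h)%g a = disp g a.
Proof. by rewrite !dispM dispV addrCA addNr addr0. Qed.

Lemma dispX g n a : disp (g ^+ n)%g a = disp g a *+ n.
Proof. by elim: n => [|n IH]; rewrite ?disp1// expgS dispM IH mulrS. Qed.

Lemma dispR g h a : disp [~ g, h]%g a = 0.
Proof. by rewrite commgEl dispM dispV dispJ addNr. Qed.

Lemma disp_gen g k : disp g e = e *+ k -> forall a, disp g a = a *+ k.
Proof.
move=> ge a; have [n ->] := um_gen um a; rewrite mulrnAC -ge.
elim: n => [|n IH]; first by rewrite !mulr0n disp0 ?mul0rn.
by rewrite !mulrS dispD IH.
Qed.

Definition cocycle_on (H : set G) (c : G -> A) :=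
  forall g h, H g -> H h -> c (g * h)%g = c g + act g (c h).

Section Cocycle.
Variables (H : set G) (sH : is_subgroup H) (c : G -> A) (cH : cocycle_on H c).

Let H1 : H 1%g. Proof. by case: sH. Qed.
Let HV x : H x -> H (x^-1)%g.
Proof. by move=> Hx; rewrite -[(x^-1)%g]mul1g; apply: sH.2. Qed.
Let HM x y : H x -> H y -> H (x * y)%g.
Proof. by move=> Hx Hy; rewrite -[y]invgK; apply: sH.2 => //; exact: HV. Qed.
Let HX x n : H x -> H (x ^+ n)%g.
Proof. by move=> Hx; elim: n => [//|n IH]; rewrite expgS; exact: HM. Qed.

Lemma cocycle1 : c 1%g = 0.
Proof.
by apply: (addrI (c 1%g)); rewrite addr0 -[in RHS](mulg1 1%g) cH// (um_act1 um).
Qed.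

Lemma cocycleM g h : H g -> H h -> (disp g (c h) = 0) -> c (g * h)%g = c g + c h.
Proof. by move=> Hg Hh gh; rewrite cH// actE gh addr0. Qed.

Lemma cocycleX g n : H g -> disp g (c g) = 0 -> c (g ^+ n)%g = c g *+ n.
Proof.
move=> Hg g0; elim: n => [|n IH]; first by rewrite cocycle1.
rewrite expgSr mulrSr cocycleM ?IH//; first exact: HX.
by rewrite dispX g0 mul0rn.
Qed.

Lemma cocycleV g : H g -> disp g (c g) = 0 -> c (g^-1)%g = - c g.
Proof.
move=> Hg g0; apply/eqP; rewrite -subr_eq0 opprK -cocycleM ?mulVg ?cocycle1//.
  exact: HV.
by rewrite dispV g0 oppr0.
Qed.

(** Expand [c] on both sides of g h = h g [g, h]. *)
Lemma cocycleR g h : H g -> H h ->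
  c [~ g, h]%g = disp g (c h) - disp h (c g).
Proof.
move=> Hg Hh; have HR : H [~ g, h]%g by do !(apply: HM || apply: HV).
move: [~ g, h]%g HR (commgC g h) => k Hk /(congr1 c).
rewrite (cH Hg Hh) (cH (HM Hh Hg) Hk) (cH Hh Hg) !actE => E; set w := RHS.
have Ew : c k + disp (h * g)%g (c k) = w.
  apply: (addrI (c h + (c g + disp h (c g)))).
  by rewrite -E /w addrACA addrK addrC.
(* [w] is p-torsion, hence so is [c k], and therefore [h * g] fixes [c k]. *)
have w0 : w *+ p = 0 by rewrite mulrnBl !disp_torsion subrr.
rewrite -Ew [disp (h * g) _]disp0 ?addr0//.
by move: w0; rewrite -Ew mulrnDl disp_torsion addr0.
Qed.

Lemma cocycle_prod (I : Type) (s : seq I) (u : I -> G) :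
  (forall i, H (u i)) -> (forall i a, disp (u i) a = 0) ->
  H (\big[*%g/1%g]_(i <- s) u i) /\
  c (\big[*%g/1%g]_(i <- s) u i) = \sum_(i <- s) c (u i).
Proof.
move=> Hu du; apply: (big_rec2 (fun x a => H x /\ c x = a)).
  by rewrite cocycle1.
by move=> i a x _ [Hx <-]; split; [exact: HM|rewrite cocycleM].
Qed.

End Cocycle.
End UnipotentModule.

(** * The surface group with an extra commutator relation *)

Definition partner (d : nat) (z : 'I_d * bool) : 'I_d * bool := (z.1, ~~ z.2).

Lemma heis_prod (p : nat) (I : Type) (s : seq I) (k : I -> 'F_p) :
  \big[*%g/1]_(i <- s) Heis 0%R 0%R 0%R 0%R (k i) =
  Heis 0%R 0%R 0%R 0%R (\sum_(i <- s) k i)%R.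
Proof.
apply: (big_rec2 (fun x a => x = Heis 0%R 0%R 0%R 0%R a)) => // i a x _ ->.
by congr Heis => /=; ring.
Qed.

Section HeisWitness.
Local Open Scope ring_scope.
Variables (p d : nat) (z1 z2 : 'I_d * bool).

(** [hs] and [ht] are dual to z_2 and to the partner of z_1. For z_1, z_2 of different index, only
    their two handles have nontrivial commutators, central with [hz] equal to 1 or -1; the sign in
    [hv] makes them cancel. *)
Definition heis_witness (x : 'I_d * bool) : heis p :=
  Heis (x == z2)%:R (x == partner z1)%:R
    ((x == z1)%:R * (-1) ^+ (z1.2 (+) z2.2)) (x == partner z2)%:R 0.

Lemma heis_witnessP q i0 : (p %| q)%N -> prime p -> z1.1 != z2.1 ->
  surface_relations q i0 z1 z2 heis_witness.
Proof.
move=> pq pp z12.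
have Fpq (a : 'F_p) : a *+ q = 0.
  by have /dvdnP[m ->] := pq; rewrite -mulr_natr natrM pchar_Fp_0// !mulr0.
rewrite /heis_witness /partner.
case: z1 z2 z12 => [i1 b1] [i2 b2] /= z12.
have i12 := negPf z12; have i21 : (i2 == i1) = false by rewrite eq_sym.
split; last first.
  by rewrite heis_commg /= !xpair_eqE i12 i21 /= !(mulr0, mul0r, subr0, addr0).
(* No generator has both [hs] and [hw], or both [ht] and [hv], nonzero; so powers are taken
   coordinatewise and the q-th power is trivial. *)
rewrite heis_expg /=; last first.
  rewrite !xpair_eqE; have [->|_] := eqVneq i0 i2; rewrite ?i21 /= ?mul0r ?addr0.
    by case: b2; rewrite /= ?mulr0 ?mul0r.
  by case: (i0 == i1); case: b1; rewrite /= ?mulr0n ?mul0r ?mulr0 ?mul0r ?addr0.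
rewrite !Fpq mul1g.
under eq_bigr => i _ do rewrite heis_commg /=.
rewrite heis_prod; congr Heis.
rewrite (bigD1 i1)//= (bigD1 i2) 1?eq_sym//= big1 => [|i /andP[ii1 ii2]].
  rewrite !xpair_eqE !eqxx i12 i21 /=.
  by case: b1; case: b2 => /=; ring.
by rewrite !xpair_eqE (negPf ii1) (negPf ii2) /= !(mulr0, mul0r, subr0, addr0).
Qed.

End HeisWitness.

Lemma neq_partner d (z : 'I_d * bool) : z != partner z.
Proof. by case: z => i []; rewrite xpair_eqE andbC. Qed.

(** * The action of the generators on A *)

Section Core.
Local Open Scope ring_scope.
Variables (p : nat) (G : groupType) (A : zmodType) (e : A)
  (act : G -> A -> A) (um : unipotent_module p e act).
Variables (d q : nat) (i0 : 'I_d) (z1 z2 : 'I_d * bool) (g : 'I_d * bool -> G).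
Hypotheses (pq : (p %| q)%N) (z12 : z1.1 != z2.1) (gP : surface_relations q i0 z1 z2 g).

(** All characters to be lifted factor through [heis p], on preimages of its subgroups [V]. The last
    clause identifies F_p with pA by sending 1 to [e *+ p]. *)
Hypothesis lift : forall u : 'I_d * bool -> heis p,
  surface_relations q i0 z1 z2 u ->
  forall (V : set (heis p)) (chi : heis p -> 'F_p),
    is_subgroup V -> (forall a b, V a -> V b -> chi (a * b)%g = chi a + chi b) ->
    exists (f : G -> heis p) (c : G -> A),
      [/\ {morph f : x y / (x * y)%g}, f \o g =1 u, cocycle_on act (f @^-1` V) c
        & forall x, V (f x) -> c x *+ p = e *+ (p * chi (f x))].

Let p_prime := um_prime um.
Let D := disp act.
Let Fpq (a : 'F_p) : a *+ q = 0.
Proof. by have /dvdnP[m ->] := pq; rewrite -mulr_natr natrM pchar_Fp_0// !mulr0. Qed.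

Let is_subgroupT : is_subgroup [set: heis p].
Proof. by []. Qed.

Let is_subgroupG : is_subgroup [set: G].
Proof. by []. Qed.

(** Elements with only [hs] nonzero commute and are killed by q, so any assignment of them to the
    generators satisfies the relations; the lifted character is [hs]. *)
Lemma indicator_lift j : exists c : G -> A, cocycle_on act setT c /\
  forall x, c (g x) *+ p = if x == j then e *+ p else 0.
Proof.
pose u x : heis p := if x == j then Heis 1 0 0 0 0 else 1%g.
have uE x : u x = Heis (x == j)%:R 0 0 0 0 by rewrite /u; case: eqP.
have uR x y : [~ u x, u y]%g = 1%g.
  by rewrite !uE heis_commg /= !mulr0 !subr0 addr0.
have uP : surface_relations q i0 z1 z2 u.
  split; last exact: uR.
  rewrite big1 ?mulg1 => [|i _]; last exact: uR.
  by rewrite uE heis_expg /= ?mulr0 ?mul0r ?addr0// !Fpq.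
have [f [c [_ fg cP cE]]] := lift uP is_subgroupT (fun a b _ _ => hsM a b).
exists c; split=> [|x]; first by move=> x y _ _; apply: cP.
rewrite cE// -[f _]/((f \o g) x) fg uE /=.
by case: eqP => _; rewrite ?mulr0n ?muln0// muln1.
Qed.

(** Commutators act trivially and have p-torsion values, so [c] is additive on the factors of the
    surface relation. *)
Lemma surface_cocycle c : cocycle_on act setT c ->
  c (g (i0, false) ^+ q)%g +
    \sum_i (D (g (i, false)) (c (g (i, true))) - D (g (i, true)) (c (g (i,
      false)))) = 0.
Proof.
move=> cP; have [_ cprod] := cocycle_prod um is_subgroupG cP (index_enum 'I_d)
  (fun i => I) (fun i => dispR um (g (i, false)) (g (i, true))).
have := congr1 c gP.1; rewrite (cocycle1 um is_subgroupG cP) (cocycleM cP)//;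
  last first.
  rewrite (disp0 um) ?cprod//.
  rewrite -sumrMnl big1// => i _.
  by rewrite (cocycleR um is_subgroupG cP)// mulrnBl !(disp_torsion um) subrr.
rewrite cprod => E; rewrite -[RHS]E; congr (_ + _); apply: eq_bigr => i _.
by rewrite (cocycleR um is_subgroupG cP).
Qed.

(** Lift the character dual to y_i. On the other generators its values are p-torsion, killed by q
    and by every g - 1, so the surface relation reduces to (x_i - 1) c(y_i) = 0, where c(y_i) agrees
    with [e] up to torsion. *)
Lemma disp_x i a : D (g (i, false)) a = 0.
Proof.
have [c [cP cE]] := indicator_lift (i, true).
have := surface_cocycle cP.
have cx k : c (g (k, false)) *+ p = 0 by rewrite cE; case: eqP => // -[].
rewrite (cocycleX um is_subgroupG cP)//; last exact: (disp0 um).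
have -> : c (g (i0, false)) *+ q = 0.
  by have /dvdnP[m ->] := pq; rewrite mulnC mulrnA cx mul0rn.
rewrite add0r (bigD1 i)//= big1 => [|k ki]; last first.
  rewrite /D [X in X - _](disp0 um); last by rewrite cE xpair_eqE (negPf ki).
  by rewrite (disp0 um) ?subr0.
rewrite /D [X in _ - X](disp0 um)// subr0 addr0 => De.
have {}De : D (g (i, false)) e = e *+ 0.
  by rewrite mulr0n -De; apply: (disp_eq um); rewrite cE eqxx.
by rewrite /D (disp_gen um De) mulr0n.
Qed.

(** For the character dual to x_i, the x_k acting trivially, the surface relation reads q c(x_1) =
    (y_i - 1) c(x_i), with x_1 the generator of index [i0]. *)
Lemma disp_y i a : D (g (i, true)) a = if i == i0 then a *+ q else 0.
Proof.
have [c [cP cE]] := indicator_lift (i, false).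
have := surface_cocycle cP.
rewrite (cocycleX um is_subgroupG cP)//; last exact: disp_x.
rewrite (bigD1 i)//= big1 => [|k ki]; last first.
  by rewrite disp_x sub0r /D (disp0 um) ?oppr0// cE xpair_eqE (negPf ki).
rewrite disp_x addr0 sub0r => /eqP; rewrite subr_eq0 => /eqP De.
have {De} : D (g (i, true)) e = e *+ (if i == i0 then q else 0).
  rewrite -(_ : D (g (i, true)) (c (g (i, false))) = D (g (i, true)) e).
    rewrite -De; have /dvdnP[m ->] := pq; rewrite mulnC mulrnA cE xpair_eqE eqxx andbT.
    by rewrite eq_sym; case: eqP => _; rewrite ?mul0rn// mulrnA.
  by apply: (disp_eq um); rewrite cE eqxx.
by move=> De; rewrite /D (disp_gen um De); case: eqP.
Qed.

(** The relation [z_1, z_2] = 1 gives (z_1 - 1) c(z_2) = (z_2 - 1) c(z_1); lifts of the characters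
    dual to z_2 and to z_1 make one side vanish each. *)
Lemma disp_z : (forall a, D (g z1) a = 0) /\ (forall a, D (g z2) a = 0).
Proof.
have z12' : z1 != z2 by apply: contraNneq z12 => ->.
have R c : cocycle_on act setT c -> D (g z1) (c (g z2)) - D (g z2) (c (g z1)) = 0.
  move=> cP; rewrite -(cocycleR um is_subgroupG cP)// gP.2.
  exact: (cocycle1 um is_subgroupG cP).
split=> a.
  have [c [cP cE]] := indicator_lift z2; have := R c cP.
  rewrite [X in _ - X](disp0 um); last by rewrite cE (negPf z12').
  rewrite subr0 => De; rewrite /D (disp_gen um (k := 0)) ?mulr0n//.
  by rewrite -De; apply: (disp_eq um); rewrite cE eqxx.
have [c [cP cE]] := indicator_lift z1; have := R c cP.
rewrite [X in X - _](disp0 um); last by rewrite cE eq_sym (negPf z12').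
rewrite sub0r => /eqP; rewrite oppr_eq0 => /eqP De.
rewrite /D (disp_gen um (k := 0)) ?mulr0n//.
by rewrite -De; apply: (disp_eq um); rewrite cE eqxx.
Qed.

(** Together these put x_1 in the kernel [H] below; the second also makes the partner of z_2 act
    trivially. *)
Hypotheses (z1y : z1 != (i0, true)) (z2x : z2 != (i0, false)).

(** * Conjugation by powers of z_2 *)

Section Conjugation.
Variables (f : G -> heis p) (c : G -> A).
Hypotheses (fM : {morph f : x y / (x * y)%g}) (fg : f \o g =1 heis_witness p z1 z2).
Let H : set G := [set x | hs (f x) = 0 /\ ht (f x) = 0].
Hypotheses (cP : cocycle_on act H c)
  (cE : forall x, H x -> c x *+ p = e *+ (p * hz (f x))).

Let fE x : f (g x) = heis_witness p z1 z2 x. Proof. exact: fg. Qed.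
Let f1 : f 1%g = 1%g.
Proof. by apply: (mulgI (f 1%g)); rewrite -fM !mulg1. Qed.
Let fV x : f (x^-1)%g = ((f x)^-1)%g.
Proof. by apply: (mulgI (f x)); rewrite -fM !mulgV. Qed.

Let hsJ x y : hs (f (x ^ y)%g) = hs (f x).
Proof. by rewrite conjgE !fM fV /= addrCA addNr addr0. Qed.
Let htJ x y : ht (f (x ^ y)%g) = ht (f x).
Proof. by rewrite conjgE !fM fV /= addrCA addNr addr0. Qed.

Let HJ x y : H x -> H (x ^ y)%g.
Proof. by move=> [sx tx]; split; rewrite ?hsJ ?htJ. Qed.

Let Fpp (a : 'F_p) : a *+ p = 0.
Proof. by rewrite -mulr_natr pchar_Fp_0// mulr0. Qed.

Let HX x : H (x ^+ p)%g.
Proof.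
have E n : hs (f (x ^+ n)%g) = hs (f x) *+ n /\ ht (f (x ^+ n)%g) = ht (f x) *+ n.
  elim: n => [|n [IHs IHt]]; first by rewrite expg0 f1.
  by rewrite expgS fM /= IHs IHt !mulrS.
by have [Es Et] := E p; split; rewrite ?Es ?Et Fpp.
Qed.

Let HR x y : H [~ x, y]%g.
Proof. by split; rewrite commgEl conjgE !fM !fV /= addrCA addKr addNr. Qed.

Let sH : is_subgroup H.
Proof.
split; first by rewrite /H /= f1.
move=> x y [sx tx] [sy ty]; split; rewrite !fM !fV /= ?sx ?sy ?tx ?ty subrr//.
Qed.

Let HM x y : H x -> H y -> H (x * y)%g.
Proof. by move=> [sx tx] [sy ty]; split; rewrite fM /= ?sx ?sy ?tx ?ty addr0. Qed.

Let HV x : H x -> H (x^-1)%g.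
Proof. by move=> [sx tx]; split; rewrite fV /= ?sx ?tx oppr0. Qed.

Let T x := forall a, D x a = 0.

Let TJ x y : T x -> T (x ^ y)%g.
Proof. by move=> Tx a; rewrite /D (dispJ um); exact: Tx. Qed.

Let TV x : T x -> T (x^-1)%g.
Proof. by move=> Tx a; rewrite /D (dispV um) [X in - X]Tx oppr0. Qed.

Let TX x n : T x -> T (x ^+ n)%g.
Proof. by move=> Tx a; rewrite /D (dispX um) [X in X *+ _]Tx mul0rn. Qed.

Let TM x y : T x -> T y -> T (x * y)%g.
Proof. by move=> Tx Ty a; rewrite /D (dispM um) [X in X + _]Tx [X in _ + X]Ty addr0.
  Qed.

Let cM x y : H x -> H y -> T x -> c (x * y)%g = c x + c y.
Proof. by move=> Hx Hy Tx; rewrite (cocycleM cP). Qed.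

Let cV x : H x -> T x -> c (x^-1)%g = - c x.
Proof. by move=> Hx Tx; rewrite (cocycleV um sH cP)//; exact: Tx. Qed.

Let cJ x y : H x -> T x -> H y -> T y -> c (x ^ y)%g = c x.
Proof.
move=> Hx Tx Hy Ty; rewrite conjgE cM ?cM ?cV//; first by rewrite addrC addrK.
- exact: HV.
- exact: HM.
- exact: TV.
Qed.

Let Hgen z : z != z2 -> z != partner z1 -> H (g z).
Proof. by move=> /negPf zz2 /negPf zz1; split; rewrite fE /= ?zz2 ?zz1. Qed.

Let Tgen z : z != (i0, true) -> T (g z).
Proof.
case: z => i [] zi a; last exact: disp_x.
by rewrite disp_y; move: zi; rewrite xpair_eqE andbT => /negPf ->.
Qed.

Let z12' : z1 != z2. Proof. by apply: contraNneq z12 => ->. Qed.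

Let Hz1 : H (g z1).
Proof. by apply: Hgen => //; exact: neq_partner. Qed.

Let Tz1 : T (g z1). Proof. exact: disp_z.1. Qed.
Let Tz2 : T (g z2). Proof. exact: disp_z.2. Qed.

Let Hz2' : H (g (partner z2)).
Proof.
apply: Hgen; first by rewrite eq_sym neq_partner.
by apply: contraNneq z12 => /(congr1 fst) /= ->.
Qed.

Let Tz2' : T (g (partner z2)).
Proof.
by apply: Tgen; apply: contraNneq z2x; case: z2 => i [] [->].
Qed.

Let Hx0 : H (g (i0, false)).
Proof.
apply: Hgen; first by rewrite eq_sym.
by apply: contraNneq z1y; case: z1 => i [] [->].
Qed.

Let TR x y : T [~ x, y]%g.
Proof. by move=> a; rewrite /D (dispR um). Qed.

(** Every factor of the conjugated surface relation lies in [H] and acts trivially, so [c] is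
    additive on it. The element [t], later a power of z_2, may lie outside [H]. *)
Lemma conj_relation t :
  \sum_i (c ([~ g (i, false), g (i, true)] ^ t)%g
    + if i == i0 then c (g (i, false) ^ t)%g *+ q else 0) = 0.
Proof.
rewrite big_split /= -big_mkcond /= big_pred1_eq.
have [Hp <-] := cocycle_prod um sH cP (index_enum 'I_d)
  (fun i => HJ t (HR (g (i, false)) (g (i, true)))) (fun i => TJ t (TR _ _)).
rewrite -(cocycleX um sH cP); [|exact: HJ|exact/TJ/disp_x].
have Tx : T ((g (i0, false) ^ t) ^+ q)%g by apply/TX/TJ/disp_x.
have Hx : H ((g (i0, false) ^ t) ^+ q)%g.
  by rewrite -conjXg; apply: HJ; elim: q => [|k IH]; [rewrite expg0;
    case: sH|rewrite expgS; exact: HM].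
rewrite addrC -cM//.
have := congr1 (fun x => c (x ^ t)%g) gP.1.
rewrite /= conjMg conjXg conj1g (cocycle1 um sH cP) => <-; congr (c (_ * _)%g).
by apply: esym; apply: (big_morph (conjg^~ t)) => [x y|]; rewrite ?conjMg ?conj1g.
Qed.

Lemma conj_invariant n i (t := (g z2 ^+ n)%g) : i != z2.1 ->
  c ([~ g (i, false), g (i, true)] ^ t)%g
    + (if i == i0 then c (g (i, false) ^ t)%g *+ q else 0) =
  c [~ g (i, false), g (i, true)]%g
    + (if i == i0 then c (g (i, false))%g *+ q else 0).
Proof.
move=> iz2; have [iz1|iz1] := eqVneq i z1.1; last first.
  have Hi b : H (g (i, b)).
    by apply: Hgen; [apply: contraNneq iz2 => <-|apply: contraNneq iz1 =>
      /(congr1 fst) /= ->].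
  (* Both generators of this handle lie in [H], so the commutator has value -(y_i - 1) c(x_i^s),
     which the q-term cancels. *)
  have E s : c ([~ g (i, false), g (i, true)] ^ s)%g
      + (if i == i0 then c (g (i, false) ^ s)%g *+ q else 0) = 0.
    rewrite conjRg (cocycleR um sH cP); try exact: HJ.
    rewrite !(dispJ um) [X in X - _]disp_x [X in _ - X + _]disp_y sub0r.
    by case: eqP => _; rewrite ?addNr// oppr0 addr0.
  by rewrite E -[X in X = _](E 1%g) !conjg1.
have z1t : (g z1 ^ t)%g = g z1.
  by apply/conjg_fixP/commgP/commuteX/commgP/eqP; exact: gP.2.
set K := [~ g z1, g (partner z1)]%g.
have cK : c (K ^ t)%g = c K.
  (* As [t] centralises z_1, [s] centralises [y]; so conjugating [y] by [t] amounts to conjugating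
     it by [s^-1 * t], which lies in [H] and acts trivially. *)
  pose y := (g z1 ^ g (partner z1))%g; pose s := (t ^ g (partner z1))%g.
  have Hy : H y by exact: HJ.
  have Ty : T y by exact: TJ.
  have ys : (y ^ s^-1)%g = y.
    by rewrite -{1}[y](_ : (y ^ s)%g = y) ?conjgK// -conjJg z1t.
  have -> : (K ^ t)%g = ((g z1)^-1 * y ^ (s^-1 * t))%g.
    by rewrite /K commgEl conjMg conjVg z1t conjgM ys.
  have Tt : T t by exact: TX.
  have Ts : T (s^-1)%g by exact/TV/TJ.
  have Hst : H (s^-1 * t)%g.
    by split; rewrite fM fV /= ?hsJ ?htJ addNr.
  have yst : H (y ^ (s^-1 * t))%g by exact: HJ.
  rewrite (cM (HV Hz1) yst (TV Tz1)) (cJ Hy Ty Hst (TM Ts Tt)).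
  by rewrite -(cM (HV Hz1) Hy (TV Tz1)).
(* For i = i0 the assumption z_1 <> y_1 forces z_1 = x_1, which [t] fixes. *)
have -> : (if i == i0 then c (g (i, false) ^ t)%g *+ q else 0) =
    (if i == i0 then c (g (i, false)) *+ q else 0).
  case: eqP => // ii0; suff -> : (i, false) = z1 by rewrite z1t.
  by move: z1y; rewrite iz1 in ii0 *; rewrite -ii0; case: (z1) => j [] //; rewrite eqxx.
congr (_ + _); move: cK; rewrite /K iz1 /partner; case: (z1) => j [] //= cK.
rewrite -[[~ g (j, false), _]%g]invgR conjVg !cV ?cK//; [exact: HJ|exact/TJ/TR].
Qed.

(** Compare the surface relation conjugated by z_2^n with the unconjugated one: all handles except
    that of z_2 cancel. *)
Lemma conj_invariant_z2 n (h := [~ g z2, g (partner z2)]%g) :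
  c (h ^ (g z2 ^+ n))%g = c h.
Proof.
have := etrans (conj_relation (g z2 ^+ n)%g) (esym (conj_relation (g z2 ^+ 0)%g)).
rewrite (bigD1 z2.1)//= [in RHS](bigD1 z2.1)//=.
rewrite (eq_bigr _ (conj_invariant n)) -(eq_bigr _ (conj_invariant 0)).
move=> /addIr; rewrite expg0 !conjg1.
(* If z_2 has index [i0], then z_2 = y_1, and y_1 - 1 acts both as 0 and as q; so q kills [A]. *)
have qc0 s : (if z2.1 == i0 then c (g (z2.1, false) ^ s)%g *+ q else 0) = 0.
  case: eqP => // z2i; have z2E : z2 = (i0, true).
    by move: z2x; rewrite -z2i; case: (z2) => j [] //; rewrite eqxx.
  by have := disp_y i0 (c (g (z2.1, false) ^ s)%g); rewrite eqxx -z2E Tz2.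
have -> : (if z2.1 == i0 then c (g (z2.1, false)) *+ q else 0) = 0.
  by have := qc0 1%g; rewrite conjg1.
rewrite qc0 !addr0 /h /partner; case: (z2) => j [] //= E.
rewrite -invgR conjVg !cV ?E//; [exact: HJ|exact/TJ/TR].
Qed.

(** These elements satisfy x_{n+1} = x_n^{z_2} h, so the induction step needs the value of [c] after
    one more conjugation by z_2; hence the free exponent [m]. *)
Lemma conj_power n m (h := [~ g z2, g (partner z2)]%g) :
  let x := (g z2 ^- n * (g z2 * h) ^+ n)%g in
  [/\ H x, T x & c (x ^ (g z2 ^+ m))%g = c h *+ n].
Proof.
elim: n m => [|n IH] m /=.
  rewrite !expg0 invg1 mul1g conj1g (cocycle1 um sH cP); split=> //; first by case: sH.
  by move=> a; exact: (disp1 um).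
have [Hx Tx _] := IH m; set x := (g z2 ^- n * _)%g in Hx Tx.
have -> : (g z2 ^- n.+1 * (g z2 * h) ^+ n.+1 = x ^ g z2 * h)%g.
  by rewrite /x conjgE !expgSr invMg !mulgA.
split; [by apply: HM; [exact: HJ|exact: HR]|by apply: TM; [exact: TJ|exact: TR]|].
rewrite conjMg -conjgM -expgS cM; [|exact: HJ|exact/HJ/HR|exact/TJ].
by have [_ _ ->] := IH m.+1; rewrite conj_invariant_z2 mulrSr.
Qed.

Lemma conj_false : False.
Proof.
have [Hx Tx] := conj_power p 0; rewrite expg0 conjg1.
set h := [~ _, _]%g => E.
have hE : (g z2 * h = g z2 ^ g (partner z2))%g by rewrite /h commgEl mulKVg.
have Hp := HX (g z2).
(* For n = p the element is z_2^{-p} times a conjugate of z_2^p by the partner of z_2. Both z_2^p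
   and that partner lie in [H] and act trivially, so [c] vanishes on it. *)
have ch0 : c h *+ p = 0.
  rewrite -E hE -conjXg cM.
  - by rewrite (cV Hp (TX p Tz2)) (cJ Hp (TX p Tz2) Hz2' Tz2') addNr.
  - exact: HV.
  - exact: HJ.
  - exact/TV/TX.
(* The lifted character takes the value 1 at [h], so p c(h) is also [e *+ p], which is nonzero. *)
have hz1 : hz (f h) = 1.
  rewrite /h commgEl conjgE !fM !fV -conjgE -commgEl !fE heis_commg /=.
  rewrite !eqxx (negPf (neq_partner z2)) [partner z2 == z2]eq_sym (negPf (neq_partner
    z2)).
  have -> : (z2 == partner z1) = false.
    by apply: contraNF z12 => /eqP ->.
  by rewrite [z2 == z1]eq_sym (negPf z12') /= !(mul0r, mulr0, subr0, addr0, mulr1).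
have := cE (HR (g z2) (g (partner z2))); rewrite -/h ch0 hz1 muln1 => /esym/eqP.
by apply/negP; exact: um_nz um.
Qed.
End Conjugation.

Lemma surface_not_liftable : False.
Proof.
pose V : set (heis p) := [set a | hs a = 0 /\ ht a = 0].
have sV : is_subgroup V.
  split; first by [].
  by move=> a b [sa ta] [sb tb]; split; rewrite /= ?sa ?sb ?ta ?tb subrr.
have chiV a b : V a -> V b -> hz (a * b)%g = hz a + hz b.
  by move=> [sa ta] _; rewrite /= sa ta !mul0r !addr0.
have [f [c [fM fg cP cE]]] := lift (heis_witnessP i0 pq p_prime z12) sV chiV.
exact: (conj_false fM fg cP cE).
Qed.
End Core.

(* The only consequence of 1-cyclotomicity that is used: the surjectivity of
   H^1(H, M/p^2) -> H^1(H, M/p) for open subgroups H, with M/p identified with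
   pM/p^2M. *)
Definition unipotent_lifting (p : nat) (G : topologicalGroupType) : Prop :=
  exists (A : zmodType) (e : A) (act : G -> A -> A),
    unipotent_module p e act /\
    forall (P : groupType) (f : G -> P) (V : set P) (chi : P -> 'F_p),
      {morph f : x y / x * y} -> open (f @^-1` [set 1]) -> is_subgroup V ->
      (forall a b, V a -> V b -> chi (a * b)%g = chi a + chi b)%R ->
      exists c : G -> A, cocycle_on act (f @^-1` V) c /\
        forall x, V (f x) -> (c x *+ p = e *+ (p * chi (f x)))%R.

Lemma surface_not_lifting (p d q : nat) (i0 : 'I_d) (z1 z2 : 'I_d * bool)
    (G : topologicalGroupType) (g : 'I_d * bool -> G) :
  prime p -> (p %| q)%N -> z1.1 != z2.1 ->
  pro_p_presentation p (surface_relations q i0 z1 z2) g ->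
  ~ unipotent_lifting p G.
Proof.
move=> pp pq z12 [_ gP univ] [A [e [act [um lift]]]].
have hlift u : surface_relations q i0 z1 z2 u ->
    forall (V : set (heis p)) (chi : heis p -> 'F_p),
    is_subgroup V -> (forall a b, V a -> V b -> chi (a * b)%g = chi a + chi b)%R ->
    exists (f : G -> heis p) (c : G -> A),
      [/\ {morph f : x y / (x * y)%g}, f \o g =1 u, cocycle_on act (f @^-1` V) c
        & forall x, V (f x) -> c x *+ p = e *+ (p * chi (f x))]%R.
  move=> uP V chi sV chiM.
  have [f [[fM fc] fg _]] := univ (discrete (heis p)) u (discrete_pro_p pp (card_heis
    pp)) uP.
  have of1 : open (f @^-1` [set 1]) by apply: open_comp => // x _; exact: fc.
  have [c [cP cE]] := lift (heis p) f V chi fM of1 sV chiM.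
  by exists f, c.
(* If z_1 = y_1 or z_2 = x_1, exchanging z_1 and z_2 restores both inequalities, since the two
   indices differ. *)
have [/andP[z1y z2x]|] := boolP ((z1 != (i0, true)) && (z2 != (i0, false))).
  exact: (surface_not_liftable um pq z12 gP hlift z1y z2x).
move=> zz.
have rsym (H : groupType) (h : _ -> H) :
    surface_relations q i0 z1 z2 h <-> surface_relations q i0 z2 z1 h.
  by split=> -[? /eqP/commgP/commute_sym/commgP/eqP].
apply: (@surface_not_liftable p G A e act um d q i0 z2 z1 g pq).
- by rewrite eq_sym.
- exact/rsym.
- by move=> u uP; exact: (hlift u (iffRL (rsym _ u) uP)).
- by apply: contraNneq z12 => z2E; move: zz;
  rewrite z2E negb_and !negbK /= xpair_eqE andbF orbF => /eqP ->.
- by apply: contraNneq z12 => z1E; move: zz;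
  rewrite z1E negb_and !negbK /= xpair_eqE andbF /= => /eqP ->.
Qed.

(** * 1-cyclotomic groups *)

Section OpenKernel.
Variables (G : topologicalGroupType) (P : groupType) (f : G -> P).
Hypothesis (fM : {morph f : x y / x * y}).

Lemma hom1 : f 1 = 1.
Proof. by apply: (mulgI (f 1)); rewrite -fM !mulg1. Qed.

Lemma homV : {morph f : x / x^-1}.
Proof. by move=> x; apply: (mulgI (f x)); rewrite -fM !mulgV hom1. Qed.

Lemma open_kernel_preimage (S : set P) :
  open (f @^-1` [set 1]) -> open (f @^-1` S).
Proof.
move=> ok; rewrite openE => x Sx.
have cx : {for x, continuous (fun y : G => x^-1 * y)}.
  have -> : (fun y : G => x^-1 * y) = (fun u : G * G => u.1 * u.2) \o (fun y =>
    (x^-1, y)) by [].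
  apply: continuous_comp; last exact: mulg_continuous.
  by apply: cvg_pair; [exact: cvg_cst|exact: cvg_id].
have : nbhs x ((fun y : G => x^-1 * y) @^-1` (f @^-1` [set 1])).
  by apply: cx; rewrite mulVg; apply: open_nbhs_nbhs; split=> //=; exact: hom1.
apply: filterS => y /=; rewrite fM homV => xy; suff -> : f y = f x by [].
by apply: (mulgI (f x)^-1); rewrite xy mulVg.
Qed.

Lemma kernel_normal : is_normal_subgroup (f @^-1` [set 1]).
Proof.
split; first split=> /=; first exact: hom1.
  by move=> x y fx fy; rewrite fM homV fx fy mulgV.
by move=> x y /= fx; rewrite conjgE !fM homV fx mul1g mulVg.
Qed.
End OpenKernel.

(** The cosets of the kernel are the fibres of [f], so the image has p-power order; this order also
    divides that of [U]. *)
Lemma pro_p_hom_trivial (p : nat) (G : topologicalGroupType) (U : finGroupType)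
    (f : G -> U) :
  prime p -> pro_p_group p G -> {morph f : x y / x * y} ->
  open (f @^-1` [set 1]) -> coprime p #|U| -> forall g, f g = 1.
Proof.
move=> pp [_ Gp] fM ok cop; have [m cm] := Gp _ (kernel_normal fM) ok.
pose S := [set u : U | `[< exists g, f g = u >]]%SET.
have SP u : u \in S <-> exists g, f g = u by rewrite inE; split=> /asboolP.
have gS : group_set S.
  apply/group_setP; split=> [|x y]; first by apply/SP; exists 1; rewrite (hom1 fM).
  by move=> /SP[a <-] /SP[b <-]; apply/SP; exists (a * b); rewrite fM.
have cS : (left_cosets (f @^-1` [set 1]) #= [set u | u \in S])%card.
  rewrite card_eq_sym.
  have -> : left_cosets (f @^-1` [set 1]) = (fun u =>
    f @^-1` [set u]) @` [set u | u \in S].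
    apply/seteqP; split => B /=.
      move=> [g _ <-]; exists (f g); first by apply/SP; exists g.
      apply/seteqP; split=> x /=; last by move=> [h h1 <-]; rewrite fM h1 mulg1.
      by move=> xg; exists (g^-1 * x); rewrite ?mulKVg// fM (homV fM) xg mulVg.
    move=> [u] /SP[g <-] <-; exists g => //.
    apply/seteqP; split=> x /=; first by move=> [h h1 <-]; rewrite fM h1 mulg1.
    by move=> xg; exists (g^-1 * x); rewrite ?mulKVg// fM (homV fM) xg mulVg.
  rewrite card_eq_sym; apply: inj_card_eq => u v; rewrite !inE => /SP[a au] _ uv.
  have : (f @^-1` [set u]) a by [].
  by rewrite uv /= => <-.
have {cm cS} cSm : #|S| = (p ^ m)%N.
  apply/card_eq_II; apply: card_eq_trans cm.
  by rewrite card_eq_sym; apply: card_eq_trans cS (card_eq_finset S).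
have S1 : #|S| = 1%N.
  have : coprime #|S| #|U| by rewrite cSm coprimeXl.
  have dv : #|S| %| #|U|.
    rewrite -[#|U|]cardsT -[S]/(gval (Group gS)).
    by apply: (cardSg (G := [set: U]%G)); apply/fintype.subsetP => x _; rewrite inE.
  by rewrite /coprime (gcdn_idPl dv) => /eqP.
move=> g; have : f g \in Group gS by apply/SP; exists g.
by rewrite (card1_trivg (G := Group gS) S1) => /set1P.
Qed.

(** * Divisibility and approximation in the p-adic integers *)

Section Padic.
Local Open Scope ring_scope.
Variable p : nat.
Hypothesis p_prime : prime p.

Fact padic_one_subproof n : ((1 : int) %% p%:Z ^+ n)%Z = ((1 : int) %% p%:Z ^+ n)%Z.
Proof. by []. Qed.
Definition padic_one := padic_of (u := fun=> 1) padic_one_subproof.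

Lemma padic_mulrn (x : padic_int p) k n :
  (x *+ k : padic_int p) n = (x n *+ k %% p%:Z ^+ n)%Z.
Proof.
elim: k => [|k IH]; first by rewrite !mulr0n.
by rewrite !mulrS /= IH modzDmr.
Qed.

Let modz_dvdm (d m x : int) : (d %| m)%Z -> ((x %% m)%Z %% d)%Z = (x %% d)%Z.
Proof. by move=> /dvdzP[c ->]; rewrite [in RHS](divz_eq x (c * d)) mulrA modzMDl. Qed.

Lemma padic_trunc (x : padic_int p) n k : (x (n + k)%N %% p%:Z ^+ n)%Z = x n.
Proof.
elim: k => [|k IH]; first by rewrite addn0 padic_mod.
by rewrite -[RHS]IH [x (n + k)%N]padic_compat addnS modz_dvdm// exprD dvdz_mulr.
Qed.

Let pX n : p%:Z ^+ n = (p ^ n)%:Z.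
Proof. by rewrite -natz -natrX natz. Qed.

Let pX_gt0 n : 0 < p%:Z ^+ n :> int.
Proof. by rewrite pX ltz_nat expn_gt0 prime_gt0. Qed.

Lemma padic_multiple (x : padic_int p) n : x n = 0 <-> exists y, x = y *+ (p ^ n).
Proof.
split=> [x0|[y ->]]; last first.
  by rewrite padic_mulrn -mulr_natr natrX natz modzMl.
(* The quotient has as coordinates those of [x], shifted by n and divided by p^n. *)
pose u k := ((x (n + k)%N) %/ p%:Z ^+ n)%Z.
have uE k : x (n + k)%N = p%:Z ^+ n * u k.
  rewrite [LHS](divz_eq _ (p%:Z ^+ n)) -/(u k) padic_trunc x0 addr0 mulrC.
  by [].
have uP k : (u k.+1 %% p%:Z ^+ k)%Z = (u k %% p%:Z ^+ k)%Z.
  apply: (mulfI (lt0r_neq0 (pX_gt0 n))).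
  rewrite !mulz_modr// -!uE -exprD addnS padic_mod.
  by rewrite [RHS]padic_compat.
exists (padic_of uP); apply: padicP => k; rewrite padic_mulrn /=.
by rewrite -mulr_natr natrX natz modzMml mulrC -uE addnC padic_trunc.
Qed.

Lemma padic_oneM k n : ((padic_one *+ k : padic_int p) n == 0) = (p ^ n %| k)%N.
Proof.
by rewrite padic_mulrn /= -mulr_natr modzMml mul1r natz pX modz_nat.
Qed.

Lemma padic_approx (x : padic_int p) n : exists k y, x = padic_one *+ k + y *+ (p ^ n).
Proof.
have xn0 : 0 <= x n by rewrite -padic_mod modz_ge0// lt0r_neq0.
exists `|x n|%N; have /padic_multiple[y xy] : (x - padic_one *+ `|x n|%N) n = 0.
  have := padic_mulrn padic_one `|x n|%N n.
  rewrite /= -mulr_natr modzMml mul1r natz gez0_abs// padic_mod => E.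
  by rewrite /= E modzDmr subrr mod0z.
by exists y; rewrite -xy addrC subrK.
Qed.
End Padic.

Section ModQuot.
Local Open Scope ring_scope.
Local Open Scope quotient_scope.
Variables (M : topologicalZmodType) (N : nat).

Lemma modproj_eq (x y : M) : modproj N x = modproj N y <-> exists z, x - y = z *+ N.
Proof.
split=> [/eqP|zP]; first by rewrite -Quotient.idealrBE => /asboolP.
by apply/eqP; rewrite -Quotient.idealrBE; apply/asboolP.
Qed.

Lemma modreprK (x : modquot M N) : modproj N (modrepr x) = x.
Proof. exact: reprK. Qed.

Lemma modprojD : {morph @modproj M N : x y / x + y}.
Proof. by move=> x y; rewrite /modproj; rewrite !piE. Qed.

Lemma modproj0 : modproj N (0 : M) = 0.
Proof. by apply: (addrI (modproj N 0)); rewrite -modprojD !addr0. Qed.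

Lemma modproj_eq0 (x : M) : modproj N x = 0 <-> exists z, x = z *+ N.
Proof. by rewrite -modproj0 modproj_eq subr0. Qed.

Lemma modprojMn k : {morph @modproj M N : x / x *+ k}.
Proof.
by move=> x; elim: k => [|k IH]; rewrite ?modproj0// !mulrS modprojD IH.
Qed.

Variable (G : topologicalGroupType) (act : G -> M -> M).
Hypothesis actP : continuous_action act.

Lemma cact0 g : act g 0 = 0.
Proof. by case: actP => _ _ aD _; apply: (addrI (act g 0)); rewrite -aD !addr0. Qed.

Lemma cactMn g x k : act g (x *+ k) = act g x *+ k.
Proof.
by case: actP => _ _ aD _; elim: k => [|k IH]; rewrite ?cact0// !mulrS aD IH.
Qed.

Lemma cactB g x y : act g (x - y) = act g x - act g y.
Proof.
by case: actP => _ _ aD _; apply: (addIr (act g y)); rewrite -aD !subrK.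
Qed.

Lemma modquot_actE g x : modquot_act act g (modproj N x) = modproj N (act g x).
Proof.
apply/modproj_eq; have /modproj_eq[z zE] := modreprK (modproj N x).
by exists (act g z); rewrite -cactB zE cactMn.
Qed.
End ModQuot.

(** * The action on M/pM and M/p^2M *)

Section Cyclotomic.
Local Open Scope ring_scope.
Variables (p : nat) (G : topologicalGroupType) (M : topologicalZmodType)
  (act : G -> M -> M).
Hypotheses (p_prime : prime p) (actP : continuous_action act).
Variables (f : M -> padic_int p) (f' : padic_int p -> M).
Hypotheses (fD : {morph f : x y / x + y}) (fK : cancel f f') (f'K : cancel f' f)
  (fC : continuous f).

Let e0 : M := f' (padic_one p).

Let f'D : {morph f' : x y / x + y}.
Proof. by move=> x y; apply: (can_inj fK); rewrite fD !f'K. Qed.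

Let f'Mn x k : f' (x *+ k) = f' x *+ k.
Proof.
have f'0 : f' 0 = 0 by apply: (addrI (f' 0)); rewrite -f'D !addr0.
by elim: k => [//|k IH]; rewrite !mulrS f'D IH.
Qed.

Let fMn x k : f (x *+ k) = f x *+ k.
Proof. by apply: (can_inj f'K); rewrite f'Mn !fK. Qed.

Lemma tate_approx m n : exists k y, m = e0 *+ k + y *+ (p ^ n).
Proof.
have [k [y E]] := padic_approx p_prime (f m) n; exists k, (f' y).
by rewrite -!f'Mn -f'D -E fK.
Qed.

Lemma tate_multiple m n : (exists y, m = y *+ (p ^ n)) <-> f m n = 0.
Proof.
rewrite padic_multiple//; split=> -[y E]; first by exists (f y); rewrite E fMn.
by exists (f' y); rewrite -f'Mn -E fK.
Qed.

(** Reduction modulo p. It uses coordinate 1, since coordinate n is a residue modulo p^n. *)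
Let rho (m : M) : 'F_p := (f m 1)%:~R.

Let pFp : p%:R = 0 :> 'F_p. Proof. exact: pchar_Fp_0. Qed.

Let Fp_mod (a : int) : (a %% p%:Z)%Z%:~R = a%:~R :> 'F_p.
Proof.
by rewrite [in RHS](divz_eq a p%:Z) [RHS]intrD [X in X + _]intrM -pmulrn pFp mulr0
  add0r.
Qed.

Let rhoD : {morph rho : x y / x + y}.
Proof. by move=> x y; rewrite /rho fD /= expr1 Fp_mod rmorphD. Qed.

Let rho0 : rho 0 = 0.
Proof. by apply: (addrI (rho 0)); rewrite -rhoD !addr0. Qed.

Let rhoMn x k : rho (x *+ k) = rho x *+ k.
Proof. by elim: k => [|k IH]; rewrite ?rho0// !mulrS rhoD IH. Qed.

Let rho_e0 : rho e0 = 1.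
Proof. by rewrite /rho f'K /= expr1 Fp_mod. Qed.

Let rho_eq0 m : rho m = 0 -> exists y, m = y *+ p.
Proof.
move=> m0; apply/(tate_multiple m 1).
have := padic_mod (f m) 1; rewrite expr1 => <-.
by apply/dvdz_mod0P; rewrite (dvdz_pcharf (pchar_Fp p_prime)); apply/eqP.
Qed.

(** M/pM is one-dimensional over F_p, so [g] acts on it by a scalar, read off from the generator
    [e0]. *)
Let rho_act g m : rho (act g m) = rho (act g e0) * rho m.
Proof.
have [k [y ->]] := tate_approx m 1; have [_ _ aD _] := actP.
rewrite aD !(cactMn actP) !rhoD !rhoMn rho_e0 expn1.
have F0 (a : 'F_p) : a *+ p = 0 by rewrite -mulr_natr pFp mulr0.
by rewrite !F0 !addr0 mulr_natr.
Qed.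

Let rhoM g h : rho (act (g * h)%g e0) = rho (act g e0) * rho (act h e0).
Proof. by have [_ aM _ _] := actP; rewrite aM rho_act. Qed.

Let rho_unit g : rho (act g e0) \is a GRing.unit.
Proof.
apply/unitrP; exists (rho (act g^-1%g e0)); have [a1 _ _ _] := actP.
by rewrite -!rhoM mulgV mulVg a1 rho_e0.
Qed.

Lemma open_action_kernel : open [set g | rho (act g e0) = 1].
Proof.
rewrite openE => g /= g1.
have cg : {for g, continuous (fun h : G => f (act h e0))}.
  apply: continuous_comp; last exact: fC.
  have -> : (fun h : G => act h e0) = (fun u : G * M => act u.1 u.2) \o (fun h =>
    (h, e0)) by [].
  have [_ _ _ aC] := actP.
  apply: continuous_comp; last exact: aC.
  by apply: cvg_pair; [exact: cvg_id|exact: cvg_cst].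
have nb : nbhs (f (act g e0)) [set x : padic_int p | x 1%N = f (act g e0) 1%N].
  rewrite nbhsE; exists [set x : padic_int p | x 1%N = f (act g e0) 1%N] => //.
  split=> //.
  by move=> x xg; exists 1%N => y yx; rewrite /= yx xg.
have : nbhs g ((fun h => f (act h e0)) @^-1`
    [set x : padic_int p | x 1%N = f (act g e0) 1%N]) by apply: cg.
by apply: filterS => h /= hg; rewrite /rho hg.
Qed.

Hypothesis Gp : pro_p_group p G.

(** The scalar action on M/pM is a homomorphism with open kernel to the units of F_p, a group of
    order p - 1, hence trivial on a pro-p group. *)
Lemma act_mod_p g m : exists y, act g m - m = y *+ p.
Proof.
apply: rho_eq0; pose theta g : {unit 'F_p} := FinRing.unit 'F_p (rho_unit g).
have thetaM : {morph theta : g h / (g * h)%g}.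
  by move=> x y; apply: val_inj; exact: rhoM.
have th1 : theta @^-1` [set 1%g] = [set g | rho (act g e0) = 1].
  by apply/seteqP; split=> x /= => [/(congr1 val)|E] //; apply: val_inj.
have tg : theta g = 1%g.
  apply: (pro_p_hom_trivial p_prime Gp thetaM).
    by rewrite th1; exact: open_action_kernel.
  rewrite -cardsT card_finField_unit card_Fp//.
  by rewrite coprime_sym coprimePn// prime_gt0.
have g1 : rho (act g e0) = 1 by have := congr1 val tg.
have rhoN x : rho (- x) = - rho x.
  by apply/eqP; rewrite -subr_eq0 opprK -rhoD addNr rho0.
by rewrite rhoD rhoN rho_act g1 mul1r subrr.
Qed.

Lemma tate_unipotent :
  unipotent_module p (modproj (p ^ 2) e0) (@modquot_act G M act (p ^ 2)).
Proof.
have [a1 aM aD _] := actP.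
split.
- exact: p_prime.
- move=> a; have [k [y E]] := tate_approx (modrepr a) 2; exists k.
  rewrite -modprojMn -[LHS]modreprK; apply/modproj_eq; exists y.
  by rewrite [modrepr a]E addrC addKr.
- by rewrite -modprojMn mulnn; apply/modproj_eq0; exists e0.
- apply/eqP; rewrite -modprojMn => /modproj_eq0/(tate_multiple _ 2)/eqP.
  rewrite fMn f'K padic_oneM// => /dvdn_leq; rewrite prime_gt0// => /(_ isT).
  by rewrite leqNgt -[X in (X < _)%N]expn1 ltn_exp2l// prime_gt1.
- by move=> a; rewrite /modquot_act a1 modreprK.
- by move=> g h a; rewrite -[a]modreprK !(modquot_actE _ actP) aM.
- move=> g a b; rewrite -[a]modreprK -[b]modreprK -modprojD !(modquot_actE _ actP).
  by rewrite aD modprojD.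
- move=> g; rewrite -modprojMn (modquot_actE _ actP) cactMn//.
  apply/modproj_eq; have [y E] := act_mod_p g e0; exists y.
  by rewrite -mulrnBl E -mulrnA.
Qed.
End Cyclotomic.

Lemma one_cyclotomic_lifting (p : nat) (G : topologicalGroupType) :
  prime p -> pro_p_group p G -> one_cyclotomic G p -> unipotent_lifting p G.
Proof.
move=> pp Gp [M [act [actP [f [f' [fD fK f'K fC _]]] surj]]].
exists (modquot M (p ^ 2)), (modproj (p ^ 2) (f' (padic_one p))),
  (@modquot_act G M act (p ^ 2)).
split; first exact: (tate_unipotent pp actP fD fK f'K fC Gp).
move=> P h V chi hM oh sV chiM.
set e0 := f' _.
have actp g m := act_mod_p pp actP fD fK f'K fC Gp g m.
have triv g (x : modquot M p) : modquot_act act g x = x.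
  by rewrite -[x]modreprK (modquot_actE _ actP); apply/modproj_eq.
(* With F_p identified with M/pM through [e0], the character is a cocycle, because the action modulo
   p is trivial. *)
pose c0 (g : G) : modquot M p := modproj p (e0 *+ chi (h g))%R.
set H := h @^-1` V.
have sH : is_subgroup H.
  split; rewrite /H /=; first by rewrite (hom1 hM); case: sV.
  by move=> x y Vx Vy; rewrite hM (homV hM); exact: sV.2.
have cH : closed H by rewrite -openC; exact: (open_kernel_preimage hM (~` V) oh).
have c0P : cocycle (@modquot_act G M act p) H c0.
  split.
    apply: continuous_subspaceT => x U /nbhs_singleton Ux.
    have := open_kernel_preimage hM [set a | U (modproj p (e0 *+ chi a)%R)] oh.
    by rewrite openE => /(_ x Ux).
  move=> x y Vx Vy.
  rewrite triv /c0 hM chiM// -modprojD -mulrnDr.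
  (* The carry in adding representatives is a multiple of p. *)
  have -> : ((chi (h x) + chi (h y))%R : nat) = ((chi (h x) + chi (h y)) %% p)%N.
    rewrite -[in LHS](natr_Zp (chi (h x))) -[in LHS](natr_Zp (chi (h y))) -natrD.
    exact: val_Fp_nat.
  apply/modproj_eq; exists (- (e0 *+ ((chi (h x) + chi (h y)) %/ p)%N))%R.
  rewrite {2}(divn_eq (chi (h x) + chi (h y)) p) mulrnDr opprD addrCA subrr addr0.
  by rewrite mulNrn -mulrnA.
have [C] := surj H 2 sH cH isT _ (ex_intro2 _ _ c0 c0P erefl).
move=> [c1 c1P <-].
have c0c0 : cohomology_class (@modquot_act G M act p) H c0 c0.
  by split=> //; exists 0%R => x _; rewrite triv !subrr.
(* Surjectivity gives a cocycle whose reduction is cohomologous to [c0]; coboundaries modulo p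
   vanish, so the reduction equals [c0]. *)
move=> E; have := c0c0; rewrite -E => -[c [cP _] [_ [a ca]]].
exists c; split; first by case: cP.
move=> x Vx.
have {}ca : modproj p (modrepr (c x)) = c0 x.
  by apply/eqP; rewrite -subr_eq0; have := ca x Vx; rewrite triv subrr => ->.
have [y yE] := (iffLR (modproj_eq _ _ _) ca).
rewrite -[c x]modreprK -!modprojMn; apply/modproj_eq; exists y.
by rewrite [(p * _)%N]mulnC mulrnA -mulrnBl yE -mulrnA.
Qed.

Local Close Scope group_scope.
Local Open Scope ring_scope.

(** * Hilbert 90 and Kummer theory *)

(** Artin's shortening: subtracting chi_i(y) times the relation at x from the relation at yx removes
    the index [i]. The relation is only required on a multiplicatively closed [S], below a fixed
    field. *)
Lemma dedekind_independence (L : fieldType) (S : set L) (I : finType)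
    (chi : I -> L -> L) :
  S 1 -> (forall x y, S x -> S y -> S (x * y)) ->
  (forall i, chi i 1 = 1) ->
  (forall i x y, S x -> S y -> chi i (x * y) = chi i x * chi i y) ->
  forall (A : {set I}) (a : I -> L),
  (forall i j, i \in A -> j \in A -> i != j -> exists2 x, S x & chi i x != chi j x) ->
  (forall x, S x -> \sum_(i in A) a i * chi i x = 0) ->
  forall i, i \in A -> a i = 0.
Proof.
move=> S1 SM chi1 chiM A; have [n leAn] := ubnP #|A|;
  elim: n A leAn => // n IH A leAn a dis sum0.
have aD i j : i \in A -> j \in A -> j != i -> a j = 0.
  move=> iA jA ji; have [y Sy yP] := dis _ _ jA iA ji.
  have : a j * (chi j y - chi i y) = 0.
    apply: (IH (A :\ i)%SET _ (fun k => a k * (chi k y - chi i y))).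
    - by move: leAn; rewrite (cardsD1 i) iA.
    - by move=> k l /setD1P[_ kA] /setD1P[_ lA]; exact: dis.
    - move=> x Sx; have E z : S z -> \sum_(k in (A :\ i)%SET) a k * chi k z
      = - (a i * chi i z).
        by move=> Sz; have := sum0 z Sz; rewrite (big_setD1 i)//= => /addr0_eq ->.
      transitivity (- (a i * chi i (y * x)) - chi i y * - (a i * chi i x)).
        rewrite -(E _ (SM _ _ Sy Sx)) -(E _ Sx) mulr_sumr -sumrB.
        by apply: eq_bigr => k kA; rewrite chiM//; ring.
      by rewrite chiM//; ring.
    - by rewrite !inE ji.
  by move/eqP; rewrite mulf_eq0 subr_eq0 (negPf yP) orbF => /eqP.
move=> i iA; have := sum0 1 S1; rewrite (big_setD1 i)//= big1 ?addr0 ?chi1 ?mulr1//.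
by move=> j /setD1P[ji jA]; rewrite (aD i j)// mul0r.
Qed.

Lemma finite_roots (L : fieldType) (q : {poly L}) : q != 0 ->
  exists s : seq L, forall z, root q z -> z \in s.
Proof.
have [n] := ubnP (size q); elim: n q => // n IH q lt_q q0.
have [[x xq]|noroot] := pselect (exists x, root q x); last first.
  by exists [::] => z zq; case: noroot; exists z.
have /factor_theorem[r rE] := xq.
have r0 : r != 0 by apply: contraNneq q0 => r0; rewrite rE r0 mul0r.
have [|s sP] := IH r _ r0.
  by move: lt_q; rewrite rE size_Mmonic ?monicXsubC// size_XsubC addn2.
exists (x :: s) => z; rewrite rE rootM root_XsubC => /orP[/sP zs|/eqP ->].
  by rewrite inE zs orbT.
by rewrite inE eqxx.
Qed.

(** * Lifting characters of Galois groups *)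

Section GaloisLifting.
Variables (K L : fieldType) (iota : {rmorphism K -> L}).
Local Notation Gam := (galois_group iota).

Let gal_zmod (s : Gam) : zmod_morphism s.
Proof. by have [] := galois_autP s. Qed.
Let gal_monoid (s : Gam) : monoid_morphism s.
Proof. by have [] := galois_autP s. Qed.
Let galD (s : Gam) x y : s (x + y) = s x + s y.
Proof.
have s0 : s 0 = 0 by have := gal_zmod s 0 0; rewrite !subrr.
by rewrite -{1}[y]opprK -[- y]sub0r !(gal_zmod s) s0 sub0r opprK.
Qed.
Let galM (s : Gam) x y : s (x * y) = s x * s y.
Proof. by have [_ ->] := gal_monoid s. Qed.
Let gal1 (s : Gam) : s 1 = 1.
Proof. by have [] := gal_monoid s. Qed.
Let galK (s : Gam) a : s (iota a) = iota a.
Proof. by have [] := galois_autP s. Qed.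
Let gal_inj (s : Gam) : injective s.
Proof. by have [sb _ _ _] := galois_autP s; exact: bij_inj. Qed.
Let gal0 (s : Gam) : s 0 = 0.
Proof. by apply: (addrI (s 0)); rewrite -galD !addr0. Qed.
Let galX (s : Gam) x n : s (x ^+ n) = s x ^+ n.
Proof. by elim: n => [|n IH]; rewrite ?gal1// !exprS galM IH. Qed.
Let gal_eq0 (s : Gam) x : (s x == 0) = (x == 0).
Proof. by rewrite -{1}(gal0 s) (inj_eq (@gal_inj s)). Qed.
Let galV (s : Gam) x : s x^-1 = (s x)^-1.
Proof.
have [->|x0] := eqVneq x 0; first by rewrite invr0 gal0 invr0.
have sx0 : s x != 0 by rewrite gal_eq0.
by apply: (mulfI sx0); rewrite -galM !divff// gal1.
Qed.
Let gal_sum (s : Gam) (I : finType) (A : {set I}) (F : I -> L) :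
  s (\sum_(i in A) F i) = \sum_(i in A) s (F i).
Proof. by apply: (big_morph s); [exact: galD|exact: gal0]. Qed.

Hypothesis L_alg : forall x : L, algebraicOver iota x.

(** For each element, add all roots in [L] of a polynomial over [K] killing it; automorphisms
    permute them. This finite set stands in for a finite Galois subextension. *)
Lemma gal_stable_hull (r : seq L) : exists2 R : seq L, {subset r <= R} &
  forall (s : Gam) x, x \in R -> s x \in R.
Proof.
elim: r => [|x r [R rR sR]]; first by exists [::].
have [q q0 qx] := L_alg x.
have [|R' R'P] := @finite_roots L (map_poly iota q); first by rewrite map_poly_eq0.
exists ([seq y <- R' | root (map_poly iota q) y] ++ R).
  move=> y; rewrite inE mem_cat mem_filter => /orP[/eqP ->|/rR ->].
    by rewrite qx R'P.
  by rewrite orbT.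
move=> s y; rewrite !mem_cat !mem_filter => /orP[/andP[yq _]|/sR ->];
  last by rewrite orbT.
suff sy : root (map_poly iota q) (s y) by rewrite sy R'P.
pose sR' : {rmorphism L -> L} := HB.pack (galois_aut s)
  (GRing.isZmodMorphism.Build _ _ _ (gal_zmod s))
  (GRing.isMonoidMorphism.Build _ _ _ (gal_monoid s)).
have <- : map_poly sR' (map_poly iota q) = map_poly iota q.
  by rewrite -map_poly_comp; apply: eq_map_poly => a /=; rewrite galK.
by rewrite (fmorph_root sR').
Qed.

(** [b] is the resolvent, the sum of phi(t)^{-1} t(x) over the finitely many restrictions to [R] of
    automorphisms over [V]; independence of characters gives an x with [b] nonzero. *)
Lemma character_hilbert90 (P : groupType) (f : Gam -> P) (V : set P) (phi : P -> K) :
  {morph f : s t / (s * t)%g} -> open (f @^-1` [set 1%g]) -> is_subgroup V ->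
  (forall a, phi a != 0) -> (forall a b, V a -> V b -> phi (a * b)%g = phi a * phi b) ->
  exists2 b : L, b != 0 & forall s : Gam, V (f s) -> s b = iota (phi (f s)) * b.
Proof.
move=> fM of1 sV phi0 phiM.
have [r rP] : exists r : seq L, forall s : Gam, {in r, s =1 id} -> f s = 1%g.
  have := krull_nbhs (s := 1%g) (U := f @^-1` [set 1%g]).
  by case; [apply: open_nbhs_nbhs; split=> //; exact: hom1|move=> r rP; exists r].
have [R rR sR] := gal_stable_hull r.
have VM a b : V a -> V b -> V (a * b)%g.
  move=> Va Vb; rewrite -[b]invgK; apply: sV.2 => //.
  by rewrite -[(b^-1)%g]mul1g; apply: sV.2 => //; case: sV.
have agree (s t : Gam) : {in R, s =1 t} ->
    f s = f t /\ forall x, (forall u : Gam, {in R, u =1 id} -> u x = x) -> s x = t x.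
  move=> st; have sti : {in R, (t^-1 * s)%g =1 id :> (L -> L)}.
    by move=> x xR /=; rewrite st// gal_invK.
  split.
    apply: (mulgI ((f t)^-1)%g); rewrite mulVg -(homV fM) -fM.
    by apply: rP => x xr; apply: sti; exact: rR.
  by move=> x Fx; rewrite -[in RHS](Fx _ sti) /= gal_invKV.
pose T := {ffun seq_sub R -> seq_sub R}.
pose A : {set T} := [set t : T | `[< exists2 s : Gam, V (f s) & forall x,
  s (val x) = val (t x) >]]%SET.
have /choice[rep repP] : forall t : T, exists s : Gam, t \in A ->
    V (f s) /\ forall x, s (val x) = val (t x).
  move=> t; have [tA|] := boolP (t \in A); last by exists 1%g.
  by move: tA; rewrite inE => /asboolP[s Vs st]; exists s.
pose tr (s : Gam) (t : T) : T := [ffun x => SeqSub (sR s _ (valP (t x)))].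
have trA s t : V (f s) -> t \in A -> tr s t \in A.
  move=> Vs tA; have [Vt tE] := repP _ tA; rewrite inE; apply/asboolP.
  exists (s * rep t)%g; first by rewrite fM; exact: VM.
  by move=> x; rewrite ffunE /= tE.
have tr_inj s : injective (tr s).
  move=> t u /ffunP tu; apply/ffunP => x; apply: val_inj.
  by have := congr1 val (tu x); rewrite !ffunE /= => /gal_inj.
have rep_tr s t : V (f s) -> t \in A -> {in R, rep (tr s t) =1 (s * rep t)%g :> (L ->
  L)}.
  move=> Vs tA x xR; have [_ E1] := repP _ tA; have [_ E2] := repP _ (trA _ _ Vs tA).
  by have := E2 (SeqSub xR); rewrite ffunE /= => ->; rewrite -E1.
(* On [F] an automorphism is determined by its restriction to [R], so the sum does not depend on the
   choice of [rep]. *)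
pose F : set L := [set x | forall u : Gam, {in R, u =1 id} -> u x = x].
have [x Fx bx] : exists2 x, F x & \sum_(t in A) (iota (phi (f (rep t))))^-1 * rep t x
  != 0.
  apply: contrapT => nox.
  have A1 : [ffun x => x] \in A.
    rewrite inE; apply/asboolP; exists 1%g; last by move=> x; rewrite ffunE.
    by rewrite (hom1 fM); case: sV.
  suff : (iota (phi (f (rep [ffun x => x]))))^-1 = 0.
    by move/eqP; rewrite invr_eq0 fmorph_eq0 (negPf (phi0 _)).
  apply: (dedekind_independence (S := F) (chi := fun t x => rep t x) _ _ _ _
    (a := fun t => (iota (phi (f (rep t))))^-1) _ _ A1).
  - by move=> u _; rewrite gal1.
  - by move=> y z Fy Fz u uR; rewrite galM Fy ?Fz.
  - by move=> t; rewrite gal1.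
  - by move=> t y z _ _; rewrite galM.
  - move=> t u tA uA tu.
    have [y yP] : exists y, t y != u y.
      by apply/existsP; rewrite -negb_forall; apply: contraNN tu => /forallP E;
        apply/eqP/ffunP => z; exact/eqP.
    exists (val y); first by move=> v vR; apply: vR; exact: valP.
    by have [_ ->] := repP _ tA; have [_ ->] := repP _ uA; rewrite (inj_eq val_inj).
  - by move=> y Fy; apply: contrapT => /eqP yP; apply: nox; exists y.
exists (\sum_(t in A) (iota (phi (f (rep t))))^-1 * rep t x) => //.
move=> s Vs; rewrite gal_sum mulr_sumr.
(* Composition with [s] permutes the restrictions, so applying [s] reindexes the sum and brings out
   the factor phi(f(s)). *)
have trA' t : (tr s t \in A) = (t \in A).
  have sub : (tr s @: A \subset A)%SET by apply/fintype.subsetP =>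
    _ /imsetP[u uA ->]; exact: trA.
  have /eqP AE : (tr s @: A == A)%SET by rewrite eqEcard sub (card_imset _ (tr_inj
    s)) leqnn.
  by rewrite -{1}AE mem_imset.
rewrite [RHS](reindex_inj (tr_inj s)) /= [RHS](eq_bigl _ _ trA').
apply: eq_bigr => t tA.
have [fE xE] := agree _ _ (rep_tr s t Vs tA).
rewrite galM galV galK fE (xE x Fx) /= fM phiM//; last by have [] := repP _ tA.
by rewrite rmorphM invfM mulrA mulVKf// fmorph_eq0.
Qed.
Variables (p : nat) (zeta : K).
Hypotheses (p_prime : prime p) (zetaP : p.-primitive_root zeta).
Hypothesis L_root : forall b : L, exists a, a ^+ p = b.

Let pp_gt1 : (1 < p * p)%N.
Proof. by rewrite (leq_trans (prime_gt1 p_prime))// leq_pmulr// prime_gt0. Qed.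

Lemma galois_unipotent_lifting : unipotent_lifting p Gam.
Proof.
have [eta etaE] := L_root (iota zeta).
(* An order dividing p would give zeta = eta^p = 1. *)
have etaP : (p * p).-primitive_root eta.
  have eta1 : eta ^+ (p * p) = 1 by rewrite exprM etaE -rmorphXn (prim_expr_order
    zetaP) rmorph1.
  have [m mP mdvd] := prim_order_exists (ltnW pp_gt1) eta1.
  suff -> : (p * p)%N = m by [].
  move: mdvd; rewrite mulnn => /(dvdn_pfactor _ _ p_prime)[i i2 mE].
  have [i1|i1] := leqP i 1; last by rewrite mE; congr (_ ^ _)%N; apply/eqP;
    rewrite eqn_leq i1 i2.
  have : zeta ^+ 1 == zeta ^+ 0.
    rewrite expr1 expr0 -(fmorph_eq1 iota) -etaE -(prim_order_dvd mP) mE.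
    by rewrite -[X in (_ %| X)%N]expn1 dvdn_exp2l.
  by rewrite (eq_prim_root_expr zetaP) modn_small ?prime_gt1// mod0n.
(* [lg] is the logarithm to base [eta]. It identifies mu_{p^2} with Z/p^2, on which automorphisms
   act by the cyclotomic character. *)
have /choice[lg lgP] : forall x : L, exists k, x ^+ (p * p) = 1 -> x = eta ^+ k.
  move=> x; have [x1|x1] := pselect (x ^+ (p * p) = 1); last by exists 0%N.
  by have [k kE] := prim_rootP etaP x1; exists k.
have lgK k l : eta ^+ k = eta ^+ l -> k%:R = l%:R :> 'Z_(p * p).
  move=> /eqP; rewrite (eq_prim_root_expr etaP) => /eqP E.
  by apply: val_inj; rewrite /= !val_Zp_nat// E.
have etaS (s : Gam) : s eta = eta ^+ lg (s eta).
  by apply: lgP; rewrite -galX (prim_expr_order etaP) gal1.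
pose act (s : Gam) (a : 'Z_(p * p)) := (lg (s eta))%:R * a.
exists 'Z_(p * p), 1, act; split.
  split.
  - exact: p_prime.
  - by move=> a; exists a; rewrite natr_Zp.
  - by apply: val_inj; rewrite /= val_Zp_nat// modnn.
  - apply/eqP => /(congr1 val); rewrite /= val_Zp_nat// modn_small ?ltn_Pmull
    ?prime_gt1 ?prime_gt0// => p0.
    by move: (prime_gt0 p_prime); rewrite p0.
  - by move=> a; rewrite /act (lgK _ 1%N) ?mul1r// -etaS expr1.
  - move=> s t a; rewrite /act mulrA -natrM; congr (_ * _).
    apply: lgK; rewrite -etaS /= {1}[t eta]etaS galX {1}etaS exprM.
    by rewrite -!exprM mulnC.
  - by move=> s a b; rewrite /act mulrDr.
  - move=> s; rewrite /act -[1 *+ p]/(p%:R) -natrM; apply: lgK.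
    by rewrite exprM -etaS -galX etaE galK.
move=> P f V chi fM of1 sV chiM.
have zeta0 : zeta != 0 by rewrite (prim_root_eq0 zetaP) -lt0n prime_gt0.
have [||b b0 bP] := @character_hilbert90 P f V (fun a => zeta ^+ chi a) fM of1 sV.
- by move=> a; rewrite expf_neq0.
- move=> x y Vx Vy; rewrite chiM// -exprD; apply/eqP; rewrite (eq_prim_root_expr zetaP).
  rewrite -[in X in X == _](natr_Zp (chi x)) -[in X in X == _](natr_Zp (chi y)) -natrD.
  by rewrite val_Fp_nat// modn_mod.
have [beta betaE] := L_root b.
have beta0 : beta != 0 by apply: contraNneq b0 => beta0;
  rewrite -betaE expf_eq0 beta0 eqxx andbT prime_gt0.
(* For [s] over [V], r(s)^p = s(b)/b is a p-th root of unity, so r(s) lies in mu_{p^2} and has a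
   logarithm. *)
pose r (s : Gam) := s beta / beta.
have rp s : V (f s) -> r s ^+ p = iota zeta ^+ chi (f s).
  by move=> Vs; rewrite expr_div_n -galX betaE bP// rmorphXn mulfK.
have rE s : V (f s) -> r s = eta ^+ lg (r s).
  move=> Vs; apply: lgP; rewrite exprM rp// -exprM mulnC exprM -rmorphXn.
  by rewrite (prim_expr_order zetaP) rmorph1 expr1n.
exists (fun s => (lg (r s))%:R); split.
  move=> s t Vs Vt; rewrite /act -natrM -natrD; apply: lgK.
  have Vst : V (f (s * t)%g).
    rewrite fM -[f t]invgK; apply: sV.2 => //.
    by rewrite -[((f t)^-1)%g]mul1g; apply: sV.2 => //; case: sV.
  rewrite -rE// exprD -rE// exprM -etaS -galX -rE//.
  by rewrite /r galM galV /=; field; rewrite gal_eq0 beta0.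
move=> s Vs; rewrite -[LHS]mulr_natr -natrM.
apply: lgK; by rewrite exprM -rE// rp// exprM etaE.
Qed.
End GaloisLifting.

(** * Galois hulls and p-extensions *)

Local Notation "p ^%:A" := (map_poly (in_alg _) p) (at level 2,
  format "p ^%:A") : ring_scope.

Section SubfieldExt.
Variables (K : fieldType) (E : fieldExtType K) (F : {subfield E}).

(** The roots of [q] generating [F] lie in [F], so they pull back along [vsval] to generators of [F]
    as an abstract field. *)
Lemma subvs_splitting (q : {poly K}) :
  splittingFieldFor 1 (q^%:A : {poly E}) F ->
  splittingFieldFor 1 (q^%:A : {poly subvs_of F}) {:subvs_of F}.
Proof.
move=> [ys Dq defF].
pose toE := linfun (vsval : subvs_of F -> E).
have ysF y : y \in ys -> y \in F by move=> y_ys; rewrite -defF seqv_sub_adjoin.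
have [zs Dys] : exists zs, map toE zs = ys.
  exists (map (vsproj F) ys); rewrite -map_comp map_id_in // => y y_ys.
  by rewrite /= lfunE /= vsprojK ?ysF.
exists zs.
  set lhs := (lhs in lhs %= _); set rhs := (rhs in _ %= rhs).
  suffices: map_poly toE lhs %= map_poly toE rhs by rewrite eqp_map.
  rewrite -Dys big_map in Dq; apply: etrans Dq; apply: congr2.
    by rewrite -map_poly_comp; apply/eq_map_poly=> x; apply: rmorph_alg.
  rewrite rmorph_prod; apply/eq_bigr=> z _.
  by rewrite rmorphB /= map_polyX map_polyC.
set Lzs := LHS; pose Lys := (toE @: Lzs)%VS; apply/vspaceP=> u.
have: val u \in Lys by rewrite /Lys aimg_adjoin_seq aimg1 Dys defF (valP u).
by case/memv_imgP=> v Lzs_v; rewrite memvf lfunE => /val_inj->.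
Qed.

Lemma dim_subvs_fullv : \dim {:subvs_of F} = \dim F.
Proof.
pose toE := linfun (vsval : subvs_of F -> E).
rewrite -(limg_dim_eq (f := toE)); last first.
  apply/eqP; rewrite -subv0; apply/subvP => u; rewrite memv_cap memv_ker => /andP[_].
  by rewrite lfunE /= -(rmorph0 (vsval : subvs_of F -> E)) memv0 => /eqP/val_inj ->.
congr (\dim _); apply/vspaceP => u; apply/idP/idP.
  by move=> /memv_imgP[v _ ->]; rewrite lfunE /= subvsP.
by move=> uF; apply/memv_imgP; exists (vsproj F u); rewrite ?memvf// lfunE /= vsprojK.
Qed.
End SubfieldExt.

(** * Elements of order prime to p in a Galois group *)

Section PElements.
Variables (p : nat) (K : fieldType) (E : splittingFieldType K).
Hypotheses (p_prime : prime p) (galE : galois 1 {:E}).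

(** The quotient of Gal(E/K) by Gal(E/M) has order p^m, so an element of order prime to p is trivial
    in it. *)
Lemma p'elt_fix (M : {subfield E}) m (s : gal_of {:E}) a :
  galois 1 M -> \dim M = (p ^ m)%N -> s \in 'Gal({:E} / 1)%g -> ((p^').-elt s)%g ->
  a \in M -> s a = a.
Proof.
move=> galM dM sG p's aM.
have sKME : (1 <= M <= {:E})%VS by rewrite sub1v subvf.
have nM : normalField 1 M by case/and3P: galM.
have := normalField_isog galE sKME nM => /card_isog cq.
have pq : (p.-group ('Gal({:E} / 1) / 'Gal({:E} / M)))%g.
  rewrite /pgroup cq -(galois_dim galM) dimv1 divn1 dM.
  by rewrite pnatX pnat_id.
have sN : s \in 'N('Gal({:E} / M))%g.
  by have /andP[_ /fintype.subsetP] := normalField_normal sKME nM; apply.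
have : coset 'Gal({:E} / M) s = 1%g.
  have sQ : (coset 'Gal({:E} / M) s \in 'Gal({:E} / 1) / 'Gal({:E} / M))%g.
    exact: mem_quotient.
  apply/eqP; rewrite -order_eq1; apply/eqP; apply: pnat_1 (mem_p_elt pq sQ) _.
  exact: (morph_p_elt (coset_morphism 'Gal({:E} / M)%g) sN p's).
move=> /coset_idr => /(_ sN) sM.
by apply: (fixed_gal _ sM) => //; exact: subvf.
Qed.

(** The elements of order prime to p generate a normal subgroup whose quotient is a p-group; [M] is
    its fixed field. *)
Lemma fixed_p_subfield (y : E) :
  (forall s, s \in 'Gal({:E} / 1)%g -> ((p^').-elt s)%g -> s y = y) ->
  exists (M : {subfield E}) (m : nat), [/\ y \in M, galois 1 M & \dim M = (p ^ m)%N].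
Proof.
move=> fixy.
pose S := [set s in 'Gal({:E} / 1)%g | ((p^').-elt s)%g]%SET.
have SG : (S \subset 'Gal({:E} / 1))%g by apply/fintype.subsetP => s;
  rewrite inE => /andP[].
have nS : (<<S>> <| 'Gal({:E} / 1))%g.
  rewrite /normal gen_subG SG /=; apply: norms_gen; apply/fintype.subsetP => s sG.
  rewrite inE; apply/fintype.subsetP => _ /imsetP[t tS ->].
  move: tS; rewrite !inE => /andP[tG pt].
  by rewrite groupJ// p_eltJ.
pose M := [aspace of fixedField <<S>>%G].
have galM : galois 1 M := normal_fixedField_galois galE nS.
have sKME : (1 <= M <= {:E})%VS by rewrite sub1v subvf.
have nM : normalField 1 M by case/and3P: galM.
have := normalField_isog galE sKME nM; rewrite gal_fixedField => /card_isog cq.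
have : (p.-group ('Gal({:E} / 1) / <<S>>))%g.
  (* By Cauchy's theorem it suffices that an element of prime order in the quotient has order p; it
     is the image of the p-part of a lift. *)
  apply/pgroupP => l l_prime /(Cauchy l_prime)[x /morphimP[t tN tG ->] ol].
  have tp'S : ((t.`_p^')%g \in <<S>>)%g.
    by rewrite mem_gen// inE groupX//= p_elt_constt.
  have tpG : ((t.`_p)%g \in 'N(<<S>>))%g by rewrite groupX.
  have tp'G : ((t.`_p^')%g \in 'N(<<S>>))%g by rewrite groupX.
  have := morph_p_elt (coset_morphism <<S>>%g) tpG (p_elt_constt p t).
  have -> : coset_morphism <<S>>%g (t.`_p)%g = coset <<S>>%g t.
    by rewrite -[in RHS](consttC p t) morphM//= (coset_id tp'S) mulg1.
  by rewrite /p_elt ol pnatE.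
move=> /card_pgroup; rewrite cq -(galois_dim galM) dimv1 divn1 => dM.
exists M; eexists; split=> //; last exact: dM.
have SY : (<<S>> \subset 'Gal({:E} / <<1; y>>))%g.
  rewrite gen_subG galois_connection ?subvf//; apply/FadjoinP; rewrite sub1v;
    split=> //.
  by apply/fixedFieldP => [|s]; [exact: memvf|rewrite inE => /andP[]; exact: fixy].
apply/fixedFieldP => [|s /(fintype.subsetP SY) sY]; first exact: memvf.
by apply: (fixed_gal _ sY); [exact: subvf|exact: memv_adjoin].
Qed.
End PElements.

(** * Finite Galois extensions inside an algebraic closure *)

Section Hull.
Variables (K : fieldType) (Omega : closedFieldType) (iota : {rmorphism K -> Omega}).
Hypothesis alg : is_algebraic_closure iota.

Lemma closed_roots (Q : {poly Omega}) : Q != 0 -> exists s : seq Omega,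
  Q %= \prod_(z <- s) ('X - z%:P).
Proof.
move=> Q0; have [s ->] := closed_field_poly_normal Q; exists s.
by apply: eqp_scale; rewrite lead_coef_eq0.
Qed.

Lemma fieldExt_contains (s : seq Omega) :
  exists (E : fieldExtType K) (f : {rmorphism E -> Omega}),
    (forall a, f a%:A = iota a) /\ forall x, x \in s -> exists y, f y = x.
Proof.
elim: s => [|x s [E [f [fA fs]]]].
  pose f : {rmorphism K^o -> Omega} := iota.
  by exists K^o, f; split=> // a; rewrite /f /= -[a%:A]/(a * 1) mulr1.
have [q [q0 qx irr_q]] : exists q : {poly E},
    [/\ q != 0, root (map_poly f q) x & irreducible_poly q].
  have ex : exists n, `[< exists q : {poly E},
      [/\ q != 0, root (map_poly f q) x & size q = n] >].
    have [q q0 qx] := alg x; exists (size q); apply/asboolP.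
    exists (q^%:A); rewrite map_poly_eq0 size_map_poly; split=> //.
    by rewrite -map_poly_comp (eq_map_poly fA).
  case: (ex_minnP ex) => n /asboolP[q [q0 qx sq]] minn; exists q; split=> //.
  apply/(subfx_irreducibleP qx q0) => r rx r0; rewrite sq; apply: minn.
  by apply/asboolP; exists r.
pose E1 := SubFieldExtType qx irr_q.
pose E2 : fieldExtType K := baseFieldType E1.
pose f2 : {rmorphism E2 -> Omega} := @subfx_inj _ _ f x q.
have f2E (a : E) : f2 (a%:A : E1) = f a by exact: subfx_inj_base.
exists E2, f2; split=> [a|y].
  by rewrite -fA -f2E.
rewrite inE => /orP[/eqP ->|/fs[z <-]]; last by exists (z%:A : E1); rewrite f2E.
by exists (subfx_root f x q); exact: subfx_inj_root.
Qed.

Lemma splitting_hull (Q : {poly K}) : Q != 0 ->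
  exists (E : splittingFieldType K) (f : {rmorphism E -> Omega}),
    [/\ forall a, f a%:A = iota a,
        forall x, root (map_poly iota Q) x -> exists y, f y = x
      & splittingFieldFor 1 (Q^%:A : {poly E}) {:E}].
Proof.
move=> Q0; have [|s Qs] := @closed_roots (map_poly iota Q);
  first by rewrite map_poly_eq0.
have [E [f [fA fs]]] := fieldExt_contains s.
have [s1 s1s] : exists s1, map f s1 = s.
  elim: s fs {Qs} => [|x s IH] fs; first by exists [::].
  have [|s1 <-] := IH; first by move=> y ys; apply: fs; rewrite inE ys orbT.
  by have [|y <-] := fs x; [rewrite inE eqxx|exists (y :: s1)].
pose F : {subfield E} := <<1 & s1>>%AS.
have splF : splittingFieldFor 1 (Q^%:A : {poly E}) F.
  exists s1 => //; rewrite -(eqp_map f) -map_poly_comp (eq_map_poly fA).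
  rewrite rmorph_prod; under [X in _ %= X]eq_bigr do
    rewrite rmorphB /= map_polyX map_polyC.
  by move: Qs; rewrite -s1s big_map.
have splF' := subvs_splitting splF.
have ax : SplittingField.axiom (subvs_of F).
  by exists (Q^%:A) => //; apply/polyOver1P; exists Q.
pose E' : splittingFieldType K := HB.pack (subvs_of F)
  (FieldExt_isSplittingField.Build K (subvs_of F) ax).
pose f' : {rmorphism E' -> Omega} := f \o (vsval : subvs_of F -> E).
exists E', f'; split=> [a|x xQ|].
- by rewrite /f' /= -fA; congr (f _); rewrite algid1.
- have : x \in s by rewrite -root_prod_XsubC -(eqp_root Qs).
  rewrite -s1s => /mapP[y ys ->]; exists (vsproj F y).
  by rewrite /f' /= vsprojK// seqv_sub_adjoin.
- exact: splF'.
Qed.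

(** The product of the [Qs] may have multiple roots, so separability is checked on the generators,
    each a root of one separable factor. *)
Lemma galois_hull (Qs : seq {poly K}) : all separable_poly Qs ->
  exists (E : splittingFieldType K) (f : {rmorphism E -> Omega}),
    [/\ forall a, f a%:A = iota a, galois 1 {:E}
      & forall Q x, Q \in Qs -> root (map_poly iota Q) x -> exists y, f y = x].
Proof.
move=> /allP sepQs; pose Q := \prod_(R <- Qs) R.
have Q0 : Q != 0.
  by rewrite prodf_seq_neq0; apply/allP => R RQ; apply: separable_poly_neq0;
    exact: sepQs.
have [E [f [fA fQ spl]]] := splitting_hull Q0; exists E, f; split=> //.
  rewrite /galois sub1v normalFieldf andbT /=.
  have [rs Drs <-] := spl; apply/separable_Fadjoin_seq/allP => z zrs.
  have : root (Q^%:A) z by rewrite (eqp_root Drs) root_prod_XsubC.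
  rewrite /Q rmorph_prod -(big_map (map_poly (in_alg E)) xpredT id).
  rewrite -[root _ _]negbK root_bigmul all_map => /allPn[R RQ /= /negPn Rz].
  apply/separable_elementP; exists (R^%:A); split=> //;
    last by rewrite separable_map sepQs.
  by apply/polyOver1P; exists R.
move=> R x RQ Rx; apply: fQ; rewrite /Q (big_rem R)//= rmorphM rootM Rx.
by [].
Qed.
End Hull.

(** * The union of the Galois p-subextensions and its p-th roots *)

Section RootClosure.
Variables (K : fieldType) (Omega : closedFieldType) (iota : {rmorphism K -> Omega}).
Hypothesis alg : is_algebraic_closure iota.
Variable (p : nat).
Hypothesis (p_prime : prime p).

Lemma root_embed (E : fieldExtType K) (f : {rmorphism E -> Omega})
    (fA : forall a, f a%:A = iota a) (Q : {poly K}) y :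
  root (map_poly iota Q) (f y) = root (Q^%:A) y.
Proof. by rewrite -(eq_map_poly fA) map_poly_comp fmorph_root. Qed.

Lemma scale_embed (E : fieldExtType K) (f : {rmorphism E -> Omega})
    (fA : forall a, f a%:A = iota a) a y : f (a *: y) = iota a * f y.
Proof. by rewrite -mulr_algl rmorphM fA. Qed.

Lemma separable_minPolyK (E : splittingFieldType K) (x : E) : galois 1 {:E} ->
  exists2 Q : {poly K}, minPoly 1 x = Q^%:A & separable_poly Q.
Proof.
move=> /and3P[_ /separableP sepE _].
have /polyOver1P[Q QE] := minPolyOver 1 x; exists Q => //.
by have := sepE x (memvf x); rewrite /separable_element QE separable_map.
Qed.

(** The polynomials are the minimal polynomials of a basis: an extension containing their roots
    contains the basis. *)
Lemma p_subextension_generators (E1 : set Omega) :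
  galois_p_subextensions p iota E1 ->
  exists2 Qs : seq {poly K}, all separable_poly Qs &
    forall (E : fieldExtType K) (f : {rmorphism E -> Omega}),
      (forall a, f a%:A = iota a) ->
      (forall Q x, Q \in Qs -> root (map_poly iota Q) x -> exists y, f y = x) ->
      E1 `<=` range f.
Proof.
move=> [E0 [f1 [galE0 _ f1A ->]]].
have /choice[mp mpP] : forall x : E0, exists Q : {poly K},
    minPoly 1 x = Q^%:A /\ separable_poly Q.
  by move=> x; have [Q ? ?] := separable_minPolyK x galE0; exists Q.
exists [seq mp x | x <- vbasis {:E0}].
  by rewrite all_map; apply/allP => x _ /=; have [] := mpP x.
move=> E f fA fQ _ [e _ <-].
rewrite (coord_vbasis (memvf e)) rmorph_sum /=.
have /choice[y yP] : forall i : 'I_(\dim {:E0}), exists y, f y = f1 (vbasis {:E0})`_i.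
  move=> i; apply: (fQ (mp (vbasis {:E0})`_i)).
    by apply: map_f; rewrite mem_nth// size_tuple.
  by rewrite root_embed// -(mpP _).1 root_minPoly.
exists (\sum_i coord (vbasis {:E0}) i e *: y i) => //.
by rewrite rmorph_sum; apply: eq_bigr => i _; rewrite !scale_embed// yP.
Qed.

(** [E0] embeds in [E] over [K], with image a Galois subextension of degree p^m, to which
    [p'elt_fix] applies. *)
Lemma p'elt_fix_subextension (E : splittingFieldType K) (f : {rmorphism E -> Omega})
    (fA : forall a, f a%:A = iota a) (E1 : set Omega) (y : E) (s : gal_of {:E}) :
  galois 1 {:E} -> galois_p_subextensions p iota E1 -> E1 `<=` range f ->
  E1 (f y) -> s \in 'Gal({:E} / 1)%g -> ((p^').-elt s)%g -> s y = y.
Proof.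
move=> galE [E0 [f1 [galE0 [m dE0] f1A ->]]] sub [e _ fe] sG sp'.
have /choice[g gP] : forall x : E0, exists y, f y = f1 x.
  by move=> x; have [|z _ zx] := sub (f1 x); [exists x|exists z].
have gB : zmod_morphism g by move=> a b; apply: (fmorph_inj f);
  rewrite rmorphB !gP rmorphB.
have gM : monoid_morphism g.
  by split=> [|a b]; apply: (fmorph_inj f); rewrite ?rmorphM !gP ?rmorphM ?rmorph1.
have gZ : scalable g by move=> a b; apply: (fmorph_inj f);
  rewrite scale_embed// !gP scale_embed.
pose gl : {lrmorphism E0 -> E} := HB.pack g (GRing.isZmodMorphism.Build _ _ g gB)
  (GRing.isMonoidMorphism.Build _ _ g gM) (GRing.isScalable.Build _ _ _ _ g gZ).
pose M : {subfield E} := [aspace of (linfun gl @: {:E0})%VS].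
have yM : y \in M.
  apply/memv_imgP; exists e; first exact: memvf.
  by rewrite lfunE; apply: (fmorph_inj f); rewrite gP.
have dM : \dim M = (p ^ m)%N.
  rewrite -dE0; apply: limg_dim_eq; apply/eqP; rewrite -subv0; apply/subvP => u.
  rewrite memv_cap memv_ker => /andP[_]; rewrite lfunE /= (fmorph_eq0 gl) => /eqP ->.
  exact: mem0v.
have galM : galois 1 M.
  have /splitting_galoisField[q [/polyOver1P[Q ->] sepQ [rs Drs defE0]]] := galE0.
  apply/splitting_galoisField; exists (Q^%:A); split.
  - by apply/polyOver1P; exists Q.
  - by move: sepQ; rewrite !separable_map.
  - exists (map (linfun gl) rs); last first.
      have <- : (linfun gl @: <<1 & rs>> = <<1 & map (linfun gl) rs>>)%VS.
        by rewrite aimg_adjoin_seq aimg1.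
      by rewrite defE0.
    have -> : Q^%:A = map_poly gl Q^%:A.
      rewrite -map_poly_comp; apply: eq_map_poly => a; apply: esym.
      exact: (rmorph_alg gl a).
    rewrite big_map.
    have -> : \prod_(z <- rs) ('X - (linfun gl z)%:P) =
        map_poly gl (\prod_(z <- rs) ('X - z%:P)).
      rewrite rmorph_prod; apply: eq_bigr => z _.
      rewrite lfunE; transitivity (map_poly gl 'X - map_poly gl z%:P).
        by rewrite map_polyX map_polyC.
      by rewrite -rmorphB.
    by rewrite eqp_map.
exact: (p'elt_fix p_prime galE galM dM sG sp' yM).
Qed.

(** A plain union; once shown to be a subfield, it is the compositum. *)
Definition p_part : set Omega := \bigcup_(E in galois_p_subextensions p iota) E.

Lemma fixed_in_p_part (E : splittingFieldType K) (f : {rmorphism E -> Omega})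
    (fA : forall a, f a%:A = iota a) (y : E) : galois 1 {:E} ->
  (forall s, s \in 'Gal({:E} / 1)%g -> ((p^').-elt s)%g -> s y = y) -> p_part (f y).
Proof.
move=> galE fixy; have [M [m [yM galM dM]]] := fixed_p_subfield galE fixy.
have /splitting_galoisField[q [/polyOver1P[Q ->] sepQ spl]] := galM.
have spl' := subvs_splitting spl.
have ax : SplittingField.axiom (subvs_of M).
  by exists (Q^%:A) => //; apply/polyOver1P; exists Q.
pose E' : splittingFieldType K := HB.pack (subvs_of M)
  (FieldExt_isSplittingField.Build K (subvs_of M) ax).
pose f' : {rmorphism E' -> Omega} := f \o (vsval : subvs_of M -> E).
exists (range f').
  exists E', f'; split=> //.
  - apply/splitting_galoisField; exists (Q^%:A); split.
    + by apply/polyOver1P; exists Q.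
    + by move: sepQ; rewrite !separable_map.
    + exact: spl'.
  - by exists m; rewrite -dM; exact: dim_subvs_fullv.
  - by move=> a; rewrite /f' /= -fA; congr (f _); rewrite algid1.
by exists (vsproj M y); rewrite /f' //= vsprojK.
Qed.

(** Two elements lie in one finite Galois extension, where membership means being fixed by all
    automorphisms of order prime to p; this is stable under field operations. *)
Lemma p_part_subfield : is_subfield p_part.
Proof.
have hull2 E1 E2 x y : galois_p_subextensions p iota E1 ->
  galois_p_subextensions p iota E2 ->
    E1 x -> E2 y -> exists (E : splittingFieldType K) (f : {rmorphism E ->
      Omega}) (a b : E),
    [/\ forall a, f a%:A = iota a, galois 1 {:E}, f a = x, f b = y &
      forall s, s \in 'Gal({:E} / 1)%g -> ((p^').-elt s)%g -> s a = a /\ s b = b].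
  move=> pE1 pE2 E1x E2y.
  have [Q1 sep1 sub1] := p_subextension_generators pE1.
  have [Q2 sep2 sub2] := p_subextension_generators pE2.
  have [|E [f [fA galE fQ]]] := @galois_hull K Omega iota alg (Q1 ++ Q2).
    by rewrite all_cat sep1.
  have s1 : E1 `<=` range f.
    by apply: sub1 => // Q z Qin; apply: fQ; rewrite mem_cat Qin.
  have s2 : E2 `<=` range f.
    by apply: sub2 => // Q z Qin; apply: fQ; rewrite mem_cat Qin orbT.
  have [a _ fa] := s1 _ E1x; have [b _ fb] := s2 _ E2y.
  exists E, f, a, b; split=> // s sG sp'; split.
    by apply: (p'elt_fix_subextension fA galE pE1 s1) => //; rewrite fa.
  by apply: (p'elt_fix_subextension fA galE pE2 s2) => //; rewrite fb.
split.
- have [E [f [fA galE _]]] := @galois_hull K Omega iota alg [::] isT.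
  by rewrite -(rmorph1 f); apply: fixed_in_p_part => // s _ _; rewrite rmorph1.
- move=> x y [E1 pE1 E1x] [E2 pE2 E2y].
  have [E [f [a [b [fA galE <- <- fix2]]]]] := hull2 _ _ _ _ pE1 pE2 E1x E2y.
  rewrite -rmorphB; apply: fixed_in_p_part => // s sG sp'.
  by have [sa sb] := fix2 s sG sp'; rewrite rmorphB /= sa sb.
- move=> x y [E1 pE1 E1x] [E2 pE2 E2y].
  have [E [f [a [b [fA galE <- <- fix2]]]]] := hull2 _ _ _ _ pE1 pE2 E1x E2y.
  rewrite -fmorph_div; apply: fixed_in_p_part => // s sG sp'.
  by have [sa sb] := fix2 s sG sp'; rewrite fmorph_div /= sa sb.
Qed.

Lemma compositum_p_part : compositum (galois_p_subextensions p iota) = p_part.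
Proof.
apply/seteqP; split; last exact: sub_gen_smallest.
by apply: smallest_sub => //; exact: p_part_subfield.
Qed.

Variable zeta : K.
Hypothesis zetaP : p.-primitive_root zeta.

(** An automorphism of order n prime to p multiplies x by zeta^i; its n-th power is the identity, so
    p divides i n, hence i, and x is fixed. *)
Lemma p_part_root x : p_part (x ^+ p) -> p_part x.
Proof.
move=> [E1 pE1 E1x].
have [->|x0] := eqVneq x 0; first by have [_ sub _] := p_part_subfield;
  rewrite -(subrr (1 : Omega)); apply: sub; have [] := p_part_subfield.
have [Q1 sep1 sub1] := p_subextension_generators pE1.
have [P sepP [P0 Px]] : exists2 P : {poly K},
  separable_poly P & ~~ root P 0 /\ root (map_poly iota P) (x ^+ p).
  have [E0 [f1 [galE0 _ f1A E1E]]] := pE1.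
  move: E1x; rewrite E1E => -[e _ fe].
  have [P PE sepP] := separable_minPolyK e galE0; exists P => //; split; last first.
    by rewrite -fe root_embed// -PE root_minPoly.
  (* If 0 were a root of [P], it would be a conjugate of [e], forcing x = 0. *)
  apply/negP => P0; have : root (minPoly 1 e) 0.
    by rewrite PE -(rmorph0 (in_alg E0)) fmorph_root.
  have /and3P[_ _ nE0] := galE0.
  move=> /(normalField_root_minPoly (sub1v _) nE0 (memvf e))[s _ /eqP].
  rewrite fmorph_eq0 => /eqP e0; move: fe; rewrite e0 rmorph0 => /esym/eqP.
  by rewrite expf_eq0 (negPf x0) andbF.
pose P' := P \Po 'X^p.
(* The derivative of P(X^p) is P'(X^p) p X^{p-1}, where p is invertible in [K] and P(0) <> 0 makes X
   prime to P(X^p). *)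
have sepP' : separable_poly P'.
  have p0 : p%:R != 0 :> K by exact: prim_root_natf_neq0 zetaP.
  move: sepP; rewrite /P' unlock deriv_comp derivXn => sepP.
  rewrite coprimepMr coprimep_comp_poly//= -scaler_nat coprimepZr//.
  rewrite coprimep_expr// coprimepX rootE horner_comp hornerXn expr0n.
  by rewrite gtn_eqF ?prime_gt0.
have [|E [f [fA galE fQ]]] := @galois_hull K Omega iota alg (P' :: Q1).
  by rewrite /= sepP'.
have s1 : E1 `<=` range f.
  by apply: sub1 => // Q z Qin; apply: fQ; rewrite inE Qin orbT.
have [y yx] : exists y, f y = x.
  apply: (fQ P'); first by rewrite inE eqxx.
  by rewrite /P' map_comp_poly map_polyXn rootE horner_comp hornerXn.
rewrite -yx; apply: fixed_in_p_part => // s sG sp'.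
have syp : s (y ^+ p) = y ^+ p.
  by apply: (p'elt_fix_subextension fA galE pE1 s1) => //; rewrite rmorphXn /= yx.
have syX : s y ^+ p = y ^+ p by rewrite -[RHS]syp rmorphXn.
have y0 : y != 0 by apply: contraNneq x0 => y0; rewrite -yx y0 rmorph0.
have zP : p.-primitive_root (zeta%:A : E) by rewrite (fmorph_primitive_root (in_alg E)).
have sz : s (zeta%:A) = zeta%:A by rewrite linearZ /= rmorph1.
have [i syi] : {i : 'I_p | s y / y = zeta%:A ^+ i}.
  by apply: (prim_rootP zP); rewrite expr_div_n syX divff// expf_neq0.
have sy : s y = zeta%:A ^+ i * y by rewrite -syi divfK.
have sn n : (s ^+ n)%g y = zeta%:A ^+ (i * n) * y.
  elim: n => [|n IH]; first by rewrite expg0 gal_id muln0 mul1r.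
  rewrite expgSr galM ?memvf// IH rmorphM rmorphXn /= sz sy mulrA -exprD.
  by rewrite mulnS addnC.
have := sn #[s]%g; rewrite expg_order gal_id => /esym/eqP.
rewrite -{2}[y]mul1r (inj_eq (mulIf y0)) -(prim_order_dvd zP) Gauss_dvdl; last first.
  by rewrite prime_coprime// -p'natE.
move=> /dvdnP[c ic].
by rewrite sy ic mulnC exprM (prim_expr_order zP) expr1n mul1r.
Qed.
End RootClosure.

(** A p-th root taken in [Omega] lies in the p-part by [p_part_root], that is, in the image of
    [L]. *)
Lemma max_p_extension_root_closed (K L : fieldType) (iota : {rmorphism K ->
  L}) p (zeta : K) :
  prime p -> p.-primitive_root zeta -> is_max_p_extension p iota ->
  (forall x : L, algebraicOver iota x) /\ (forall b : L, exists a, a ^+ p = b).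
Proof.
move=> pp zP [Omega [j [alg rj]]]; split.
  move=> x; have [q q0 qx] := alg (j x); exists q => //.
  by move: qx; rewrite map_poly_comp fmorph_root.
move=> b; have /closed_rootP[c] : size ('X^p - (j b)%:P) != 1%N.
  by rewrite size_XnsubC ?prime_gt0// eqSS -lt0n prime_gt0.
rewrite rootE !hornerE subr_eq0 => /eqP cb.
have : p_part (j \o iota) p c.
  apply: (p_part_root alg pp zP).
  by rewrite cb -compositum_p_part// -rj; exists b.
rewrite -compositum_p_part// -rj => -[a _ ac]; exists a.
by apply: (fmorph_inj j); rewrite rmorphXn /= ac.
Qed.

Local Close Scope ring_scope.

(** * Transport along isomorphisms and conclusion *)

Lemma unipotent_lifting_isog (p : nat) (G H : topologicalGroupType) :
  topgroup_isog G H -> unipotent_lifting p H -> unipotent_lifting p G.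
Proof.
move=> [F [F' [FM FK F'K _ F'C]]] [A [e [act [um lift]]]].
have F'M : {morph F' : x y / (x * y)%g}.
  by move=> x y; apply: (can_inj FK); rewrite FM !F'K.
exists A, e, (fun g => act (F g)); split.
  case: um => pp gen ord nz a1 aM aD ap; split=> //.
  - by move=> a; rewrite (hom1 FM).
  - by move=> g h a; rewrite FM aM.
move=> P f V chi fM of1 sV chiM.
have [||c [cP cE]] := lift P (f \o F') V chi _ _ sV chiM.
- by move=> x y /=; rewrite F'M fM.
- by rewrite comp_preimage; apply: open_comp => // x _; exact: F'C.
exists (c \o F); split.
  by move=> x y Vx Vy /=; rewrite FM cP//= FK.
by move=> x Vx /=; rewrite cE /= FK.
Qed.

Theorem theorem1p2 (p d : nat) (k : option nat) (z1 z2 : 'I_d * bool)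
    (p_prime : prime p) (d_ge2 : (2 <= d)%N)
    (k_ge1 : forall m : nat, k = Some m -> (1 <= m)%N)
    (k_ge2 : forall m : nat, p = 2%N -> k = Some m -> (2 <= m)%N)
    (z12 : z1 <> z2)
    (z12_xy : forall i : 'I_d, [set z1; z2] <> [set gen_x i; gen_y i])
    (G : topologicalGroupType) (g : 'I_d * bool -> G)
    (G_pres : pro_p_presentation p
       (surface_relations (ext_expn p k) (Ordinal (ltnW d_ge2)) z1 z2) g) :
  ~ one_cyclotomic G p /\
  (forall (K L : fieldType) (iota : {rmorphism K -> L}) (zeta : K),
     (p.-primitive_root zeta)%R ->
     (p = 2%N -> exists i : K, (i ^+ 2 = -1)%R) ->
     is_max_p_extension p iota ->
     ~ topgroup_isog G (galois_group iota)).
Proof.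
have pq : (p %| ext_expn p k)%N.
  case: k k_ge1 {k_ge2 G_pres} => [m /(_ m erefl) m1|_]; last exact: dvdn0.
  by rewrite -{1}[p]expn1 dvdn_exp2l.
(* Two distinct generators of the same index i are x_i and y_i in some order. *)
have z12i : z1.1 != z2.1.
  apply: contra_not_neq (z12_xy z1.1) => i12.
  case: z1 z2 z12 i12 {z12_xy G_pres} => [i b1] [j b2] /= z12 ij.
  rewrite -ij in z12 *; case: b1 b2 z12 => [] [] // _; exact: setUC.
have notlift := surface_not_lifting p_prime pq z12i G_pres.
split=> [cyc|K L iota zeta zetaP _ maxL isog]; apply: notlift.
  by case: G_pres => Gp _ _; exact: one_cyclotomic_lifting.
have [L_alg L_root] := max_p_extension_root_closed p_prime zetaP maxL.
apply: (unipotent_lifting_isog isog).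
exact: (galois_unipotent_lifting L_alg p_prime zetaP L_root).
Qed.
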